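(* The set of all pairs $(L_0,L_1)\in\mathcal{W}$ having a unique maximising measure is a dense $G_\delta$ subset of $\mathcal{W}$.
   Context: Let $\mathcal{H}$ be a real separable Hilbert space with orthonormal basis $\{e_i: i\in\mathbb{Z}\}$, and let $\mathcal{B}(\mathcal{H})$ be the bounded linear operators on $\mathcal{H}$ with the operator norm topology. A weighted shift operator is a bounded linear operator $L$ on $\mathcal{H}$ such that $Le_i=\alpha_i e_{i+1}$ for all $i\in\mathbb{Z}$, for some real coefficients $\alpha_i$. $\mathcal{W}\subset\mathcal{B}(\mathcal{H})^2$ denotes the set of all pairs $(L_0,L_1)$ of bounded, invertible weighted shift operators with positive coefficients (so each coefficient sequence is bounded and bounded away from zero), with the topology induced by the operator norm. $\Sigma_2=\{0,1\}^{\mathbb{Z}}$ has the product topology and $\sigma[(x_i)_{i\in\mathbb{Z}}]=(x_{i+1})_{i\in\mathbb{Z}}$. $\mathcal{M}_\sigma$ is the set of $\sigma$-invariant Borel probability measures on $\Sigma_2$. For $(L_0,L_1)\in\mathcal{W}$, the joint spectral radius is $\varrho(L_0,L_1)=\lim_{n\to\infty}\sup_{x_1,\dots,x_n\in\{0,1\}}\|L_{x_n}\cdots L_{x_1}\|^{1/n}$. A measure $\mu\in\mathcal{M}_\sigma$ is a maximising measure of $(L_0,L_1)$ if $\lim_{n\to\infty}\frac1n\int\log\|L_{x_n}\cdots L_{x_1}\|\,d\mu(x)=\log\varrho(L_0,L_1)$. *)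

(* Defs.v *)
From HB Require Import structures.
From mathcomp Require Import all_boot all_order all_algebra.
From mathcomp Require Import all_classical all_reals all_analysis.

Set Implicit Arguments.
Unset Strict Implicit.
Unset Printing Implicit Defensive.

Import Order.TTheory GRing.Theory Num.Theory.
Import numFieldNormedType.Exports.

Local Open Scope classical_set_scope.
Local Open Scope ring_scope.

Section BoundedOperators.
Variables (R : realType) (H : normedModType R).

Definition bounded_linear : {pred H -> H} :=
  fun f => `[< linear f /\ exists M : R, forall x, `|f x| <= M * `|x| >].

Record bounded_op := BoundedOp {
  op_fun :> H -> H;
  _ : op_fun \in bounded_linear }.

HB.instance Definition _ := [isSub for op_fun].
HB.instance Definition _ := [Choice of bounded_op by <:].

Lemma bounded_opP (L : bounded_op) :
  linear L /\ exists M : R, forall x, `|L x| <= M * `|x|.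
Proof. by case: L => f /= fP; move: (fP); rewrite unfold_in => /asboolP. Qed.

Lemma bounded_linear_submod_closed : submod_closed bounded_linear.
Proof.
split.
  rewrite unfold_in; apply/asboolP; split.
    by move=> a u v; rewrite /= scaler0 addr0.
  by exists 0 => x; rewrite normr0 mul0r.
move=> a f g; rewrite !unfold_in => /asboolP[fl [M fM]] /asboolP[gl [N gN]].
apply/asboolP; split.
  move=> b u v; rewrite !fctE fl gl !scalerDr !scalerA [a * b]mulrC.
  by rewrite addrACA.
exists (`|a| * M + N) => x; rewrite !fctE.
rewrite (le_trans (ler_normD _ _))// normrZ mulrDl lerD// -mulrA.
by rewrite ler_wpM2l.
Qed.

HB.instance Definition _ := GRing.isSubmodClosed.Build _ _ bounded_linear
  bounded_linear_submod_closed.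
HB.instance Definition _ := [SubChoice_isSubLmodule of bounded_op by <:].

Definition opnorm (L : bounded_op) : R :=
  sup [set `|L x| | x in [set x : H | `|x| <= 1]].

Lemma opnorm_has_sup (L : bounded_op) :
  has_sup [set `|L x| | x in [set x : H | `|x| <= 1]].
Proof.
split; first by exists `|L 0|, 0; rewrite //= normr0.
have [_ [M LM]] := bounded_opP L.
exists `|M| => _ [x /= x1 <-].
rewrite (le_trans (LM x))// (le_trans (ler_wpM2r _ (ler_norm M)))//.
by rewrite ler_piMr.
Qed.

Lemma opnorm_ub (L : bounded_op) x : `|x| <= 1 -> `|L x| <= opnorm L.
Proof.
by move=> x1; apply: sup_ubound; [exact: (opnorm_has_sup L).2 | exists x].
Qed.

Lemma opnorm_lub (L : bounded_op) (M : R) :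
  (forall x, `|x| <= 1 -> `|L x| <= M) -> opnorm L <= M.
Proof.
move=> LM; apply: ge_sup; first exact: (opnorm_has_sup L).1.
by move=> _ [x /= x1 <-]; exact: LM.
Qed.

Lemma opnormD (L M : bounded_op) : opnorm (L + M) <= opnorm L + opnorm M.
Proof.
apply: opnorm_lub => x x1.
by rewrite (le_trans (ler_normD _ _))// lerD// opnorm_ub.
Qed.

Lemma opnormZ_le (a : R) (L : bounded_op) :
  opnorm (a *: L) <= `|a| * opnorm L.
Proof.
by apply: opnorm_lub => x x1; rewrite normrZ ler_wpM2l// opnorm_ub.
Qed.

Lemma opnormZ (a : R) (L : bounded_op) : opnorm (a *: L) = `|a| * opnorm L.
Proof.
apply/eqP; rewrite eq_le opnormZ_le/=.
have [->|a0] := eqVneq a 0.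
  rewrite normr0 mul0r; apply: le_trans (opnorm_ub (x := 0) _ _) => //.
  by rewrite normr0.
have aN : 0 < `|a| by rewrite normr_gt0.
rewrite -ler_pdivlMl// -normfV -{1}[L](scalerK a0).
exact: opnormZ_le.
Qed.

Lemma opnorm0_eq0 (L : bounded_op) : opnorm L = 0 -> L = 0.
Proof.
move=> L0; apply/val_inj/funext => x /=.
have [linL _] := bounded_opP L.
have L00 : L 0 = 0.
  by have := linL (-1) 0 0; rewrite scaler0 addr0 scaleN1r addNr.
have [->|x0] := eqVneq x 0; first exact: L00.
have xN : `|x| != 0 by rewrite normr_eq0.
have : `|L (`|x|^-1 *: x)| <= 0.
  by rewrite -L0 opnorm_ub// normrZ normfV normr_id mulVf.
have -> : L (`|x|^-1 *: x) = `|x|^-1 *: L x.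
  by have := linL `|x|^-1 x 0; rewrite L00 !addr0.
by rewrite normr_le0 scaler_eq0 invr_eq0 (negPf xN) => /eqP.
Qed.

HB.instance Definition _ :=
  @Lmodule_isNormed.Build R bounded_op opnorm opnormD opnormZ opnorm0_eq0.

Lemma op_id_subproof : (fun x : H => x) \in bounded_linear.
Proof.
rewrite unfold_in; apply/asboolP; split; first by [].
by exists 1 => x; rewrite mul1r.
Qed.

Definition op_id : bounded_op := BoundedOp op_id_subproof.

Lemma op_comp_subproof (L M : bounded_op) :
  (fun x : H => L (M x)) \in bounded_linear.
Proof.
have [linL [a La]] := bounded_opP L; have [linM [b Mb]] := bounded_opP M.
rewrite unfold_in; apply/asboolP; split.
  by move=> c u v; rewrite linM linL.
exists (`|a| * b) => x.
rewrite (le_trans (La _))// (le_trans (ler_wpM2r _ (ler_norm a)))//.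
by rewrite -mulrA ler_wpM2l.
Qed.

Definition op_comp (L M : bounded_op) : bounded_op :=
  BoundedOp (op_comp_subproof L M).

Definition invertible_op (L : bounded_op) :=
  exists M, op_comp L M = op_id /\ op_comp M L = op_id.

End BoundedOperators.

Section WeightedShifts.
Variables (R : realType) (H : normedModType R).

Definition orthonormal_basis (dot : {dot H for idfun}) (e : int -> H) :=
  (forall i j, dot (e i) (e j) = (i == j)%:R) /\
  closure [set x | exists (s : seq int) (c : int -> R),
                     x = \sum_(i <- s) c i *: e i] = [set: H].

Definition weighted_shift (e : int -> H) (alpha : int -> R)
    (L : bounded_op H) :=
  forall i, L (e i) = alpha i *: e (i + 1).

Definition positive_invertible_shift (e : int -> H) (L : bounded_op H) :=
  invertible_op L /\
  exists2 alpha, (forall i, 0 < alpha i) & weighted_shift e alpha L.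

(* As a type, this carries the topology induced by the product of the operator
   norm topologies. *)
Definition shift_pairs (e : int -> H) : set (bounded_op H * bounded_op H) :=
  [set L | positive_invertible_shift e L.1 /\ positive_invertible_shift e L.2].

End WeightedShifts.

Definition full_shift := g_sigma_algebraType (@open {ptws int -> bool}).

Definition shift_map (x : full_shift) : full_shift := fun i => x (i + 1).

Definition shift_invariant (R : realType) (mu : probability full_shift R) :=
  forall A, measurable A -> mu (shift_map @^-1` A) = mu A.

Section MaximisingMeasures.
Variables (R : realType) (H : normedModType R).
Implicit Type L : bounded_op H * bounded_op H.

(* [word_op L [:: x_1; ...; x_n]] is L_{x_n} ... L_{x_1}, where [false] and
   [true] stand for the symbols 0 and 1. *)
Definition word_op L (w : seq bool) : bounded_op H :=
  foldl (fun A b => op_comp (if b then L.2 else L.1) A) (op_id H) w.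

(* The coordinates x_1, ..., x_n. *)
Definition prefix_word (x : full_shift) (n : nat) : seq bool :=
  [seq x k%:Z | k <- iota 1 n].

Definition joint_spectral_radius L : R :=
  lim ((fun n : nat => sup [set `|word_op L w| `^ n%:R^-1
                           | w in [set: n.-tuple bool]]) @ \oo).

Definition maximising_measure L (mu : probability full_shift R) :=
  shift_invariant mu /\
  (fun n : nat => n%:R^-1 * \int[mu]_x ln `|word_op L (prefix_word x n)|) @ \oo
    --> ln (joint_spectral_radius L).

(* Measures are compared on measurable sets only: the values that a term of
   type [probability] takes on the other sets are irrelevant. *)
Definition unique_maximising_measure L :=
  exists2 mu, maximising_measure L mu &
    forall nu, maximising_measure L nu ->
      forall A, measurable A -> nu A = mu A.

End MaximisingMeasures.

(* Main.v *)
(** Let [a b i] be the logarithms of the weights. The norm of a product of shifts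
    is the supremum of its coefficients, so that
    [ln ||L_{x_n} ... L_{x_1}|| = sup_i sum_(k < n) a x_{k+1} (i + k)], and since
    the word is free, [ln rho] is the growth rate of the sums of
    [peak i = max (a 0 i) (a 1 i)] over long windows.

    [G_delta]: measures that are optimal for [L_t] converge, along an ultrafilter
    with [L_t --> L], to a measure that is optimal for [L]. Hence, for each
    cylinder [C] and [d > 0], the condition that any two maximising measures
    differ by less than [d] on [C] is open, and uniqueness is a countable
    intersection of such conditions.

    Density: raise the larger weight at every site by [eps]. Any word that is
    nearly optimal over a window must now agree at most sites with the sequence
    [best] of preferred symbols. If [g i] indicates that [best], translated by
    [i], lies in [C], then adding [t * g] to both weights changes the growth rate
    by at least [t * mu C] for every maximising [mu] and every real [t], that is,
    [mu C] is a subgradient of the growth rate in the direction [g]. So it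
    suffices that the growth rate have small second differences in the countably
    many directions [g] at once, which is arranged by successive small
    perturbations because the growth rate is Lipschitz. *)

From HB Require Import structures.
Require Import Defs.
From mathcomp Require Import all_boot all_order all_algebra.
From mathcomp Require Import all_classical all_reals all_analysis.
From mathcomp Require Import borel_hierarchy.
From mathcomp Require Import ring lra zify.
Import Order.TTheory GRing.Theory Num.Theory.
Import numFieldNormedType.Exports.
Set Implicit Arguments.
Unset Strict Implicit.
Unset Printing Implicit Defensive.
Local Open Scope classical_set_scope.
Local Open Scope ring_scope.

(** * Cylinder sets and the Borel structure of the shift space *)

Section Cylinders.

Definition cyl (s : seq (int * bool)) : set full_shift :=
  [set x | all (fun p => x p.1 == p.2) s].

Lemma cyl_nil : cyl [::] = setT.
Proof. by apply/seteqP; split => x. Qed.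

Lemma cyl_cat s t : cyl (s ++ t) = cyl s `&` cyl t.
Proof.
by apply/seteqP; split => x; rewrite /cyl/= all_cat => /andP.
Qed.

Lemma cyl_cons p s : cyl (p :: s) = [set x : full_shift | x p.1 = p.2] `&` cyl s.
Proof.
by apply/seteqP; split => x; rewrite /cyl/=; [move=> /andP[/eqP]|move=> [->]; rewrite eqxx].
Qed.

Lemma open_cyl s : open (cyl s : set {ptws int -> bool}).
Proof.
elim: s => [|[i b] s IH]; first by rewrite cyl_nil; exact: openT.
rewrite cyl_cons; apply: openI => //=.
rewrite (_ : [set _ | _] = (@proj int (fun=> bool) i) @^-1` [set b]); last first.
  by apply/seteqP; split.
apply: open_comp; last exact: discrete_open.
by move=> x _; exact: proj_continuous.
Qed.

Lemma nbhs_cyl (x : {ptws int -> bool}) U :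
  nbhs x U -> exists2 s, cyl s x & cyl s `<=` U.
Proof.
(* The cylinders around [x] generate a filter. It converges to [x] in each coordinate, hence in the
   product topology, so it contains every neighbourhood of [x]. *)
pose F : set_system {ptws int -> bool} :=
  [set A | exists2 s, cyl s x & cyl s `<=` A].
have FF : Filter F.
  split.
  - by exists [::]; rewrite ?cyl_nil.
  - move=> A B [s sx sA] [t tx tB]; exists (s ++ t); rewrite cyl_cat; first by split.
    by move=> y [/sA ? /tB].
  - by move=> A B AB [s sx sA]; exists s => //; exact: subset_trans AB.
have : {ptws, F --> (x : int -> bool)}.
  apply/cvg_sup => i A [B [[V oV <-] /= Vx BA]].
  exists [:: (i, x i)]; first by rewrite /cyl/= eqxx.
  by move=> y; rewrite /cyl/= andbT => /eqP yx; apply: BA; rewrite /= yx.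
by apply.
Qed.

Lemma measurable_cyl s : measurable (cyl s).
Proof. by apply: sub_sigma_algebra; exact: open_cyl. Qed.

Lemma open_bigcup_cyl (U : set {ptws int -> bool}) : open U ->
  U = \bigcup_(s in [set s | cyl s `<=` U]) cyl s.
Proof.
move=> oU; apply/seteqP; split => [x Ux|x [s sU]]; last exact: sU.
have [s sx sU] := nbhs_cyl (open_nbhs_nbhs (conj oU Ux)).
by exists s.
Qed.

Definition cyls := [set cyl s | s in [set: seq (int * bool)]].

(** Codes of cylinders are countably many, so every open set is a countable union of cylinders. *)
Lemma measurable_full_shiftE : measurable = <<s cyls >> :> set (set full_shift).
Proof.
apply/seteqP; split; last first.
  apply: smallest_sub; first exact: sigma_algebra_measurable.
  by move=> _ [s _ <-]; exact: measurable_cyl.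
apply: smallest_sub; first exact: smallest_sigma_algebra.
move=> U /= /open_bigcup_cyl ->.
rewrite bigcup_mkcond.
have mc s : (<<s cyls >>) (if s \in [set s | cyl s `<=` U] then cyl s else set0).
  case: ifP => _; last exact: sigma_algebra0.
  by apply: sub_sigma_algebra; exists s.
exact: (@countable_bigcupT_measurable _ (g_sigma_algebraType cyls) _
  (fun s => if s \in [set s | cyl s `<=` U] then cyl s else set0)).
Qed.

Lemma eq_probability_cyl (R : realType) (mu nu : probability full_shift R) :
  (forall s, mu (cyl s) = nu (cyl s)) -> forall A, measurable A -> mu A = nu A.
Proof.
move=> mn A mA.
apply: (measure_unique cyls (fun=> setT)) => //.
- exact: measurable_full_shiftE.
- by move=> _ _ [s _ <-] [t _ <-]; exists (s ++ t) => //; rewrite cyl_cat.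
- by move=> _; exists [::] => //; rewrite cyl_nil.
- by rewrite bigcup_const.
- by move=> _ [s _ <-]; exact: mn.
- by move=> _; rewrite [X in (X < _)%E]probability_setT ltry.
Qed.

End Cylinders.

(** * Finitely additive contents on cylinders and their extension to probabilities *)

Section Contents.
Variable R : realType.
Implicit Types (m : seq (int * bool) -> R) (s : seq (int * bool)) (u : seq bool).

(** Several codes describe the same cylinder, whence the third clause. Additivity is stated for
    splitting along one coordinate: each clause then involves finitely many values and passes to
    pointwise limits. *)
Definition cyl_content m :=
  [/\ m [::] = 1, forall s, 0 <= m s, forall s t, cyl s = cyl t -> m s = m t &
      forall s i, m s = m ((i, true) :: s) + m ((i, false) :: s)].

Lemma cyl_split s i : cyl s = cyl ((i, true) :: s) `|` cyl ((i, false) :: s).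
Proof.
apply/seteqP; split => x; rewrite !cyl_cons/=; last by case=> -[].
by move=> sx; case E: (x i); [left|right].
Qed.

Lemma cyl_content_probability (mu : probability full_shift R) :
  cyl_content (fun s => fine (mu (cyl s))).
Proof.
split.
- by rewrite cyl_nil probability_setT.
- by move=> s; rewrite fine_ge0.
- by move=> s t ->.
- move=> s i; rewrite {1}(cyl_split s i) measureU; last 3 first.
    exact: measurable_cyl.
    exact: measurable_cyl.
    by apply/seteqP; split => // x; rewrite !cyl_cons/= => -[[-> _] []].
  by rewrite fineD// fin_num_measure//; exact: measurable_cyl.
Qed.

(** Imposing either letter at the site 0 leaves an empty cylinder empty, so additivity reads
    [m s = m s + m s]. *)
Lemma cyl_content0 m s : cyl_content m -> cyl s = set0 -> m s = 0.
Proof.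
move=> [_ _ mE mD] s0.
have E b : m ((0, b) :: s) = m s by apply: mE; rewrite cyl_cons s0 setI0.
by have := mD s 0; rewrite !E => /eqP; rewrite -{1}[m s]addr0 (inj_eq (addrI _)) => /eqP.
Qed.

(** The enumeration 0, -1, 1, -2, ... of the sites. Deciding the letters in this order arranges the
    cylinders in a binary tree that reaches every site. *)
Definition znth (n : nat) : int := if odd n then Negz n./2 else n./2%:Z.
Definition zindex (i : int) : nat :=
  match i with Posz n => n.*2 | Negz n => n.*2.+1 end.

Lemma znthK : cancel znth zindex.
Proof.
move=> n; rewrite /znth; case: ifP => /= on; last by rewrite halfK on subn0.
by rewrite halfK on subn1 prednK//; case: n on.
Qed.

Lemma zindexK : cancel zindex znth.
Proof.
by case=> n; rewrite /znth /= odd_double/= ?doubleK// uphalf_double.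
Qed.

(* Words are read from right to left, so that consing is refining. *)
Fixpoint code u : seq (int * bool) :=
  if u is b :: u' then (znth (size u'), b) :: code u' else [::].

(** The word [u] decides all sites of index below [n], so constraints on these sites either
    contradict it or follow from it. *)
Lemma cyl_cat_code n (s : seq (int * bool)) u : size u = n ->
  all (fun p => zindex p.1 < n)%N s ->
  cyl (s ++ code u) = set0 \/ cyl (s ++ code u) = cyl (code u).
Proof.
move=> un sn; have [->|/set0P[x]] := eqVneq (cyl (s ++ code u)) set0; [by left|].
rewrite cyl_cat => -[sx ux]; right; apply/setIidPr => y uy.
suff xy : forall k, (k < n)%N -> x (znth k) = y (znth k).
  rewrite /cyl/=; apply/allP => p ps.
  by rewrite -[p.1]zindexK -xy ?(allP sn)// zindexK; exact: (allP sx).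
move=> {sx sn s}.
move=> k; elim: u n un ux uy => [|b u IH] [|n]//= [un].
rewrite !cyl_cons/= => -[xb ux] [yb uy].
rewrite ltnS leq_eqVlt => /orP[/eqP->|]; last exact: IH.
by rewrite -un xb yb.
Qed.

(** Any cylinder splits, by additivity, along the tree of words until all its sites are decided. The
    induction is on the number [k] of letters still to be added to [u]. *)
Lemma eq_cyl_content m m' : cyl_content m -> cyl_content m' ->
  (forall u, m (code u) = m' (code u)) -> m =1 m'.
Proof.
move=> cm cm' mm' s.
pose n := (\max_(p <- s) (zindex p.1).+1)%N.
have sn : all (fun p => zindex p.1 < n)%N s.
  by apply/allP => p ps; rewrite /n (big_rem p)//= leq_maxl.
suff H k u : (size u + k)%N = n -> m (s ++ code u) = m' (s ++ code u).
  by have := H n [::]; rewrite cats0; exact.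
elim: k u => [|k IH] u.
  rewrite addn0 => un; have [s0|su] := cyl_cat_code un sn.
    by rewrite !cyl_content0.
  case: cm cm' => [_ _ mE _] [_ _ mE' _].
  by rewrite (mE _ _ su) (mE' _ _ su) mm'.
move=> un; case: (cm) (cm') => [_ _ mE mD] [_ _ mE' mD'].
rewrite (mD _ (znth (size u))) (mD' _ (znth (size u))).
have E b : cyl ((znth (size u), b) :: s ++ code u) = cyl (s ++ code (b :: u)).
  by rewrite /= cyl_cons !cyl_cat cyl_cons setICA.
by rewrite !(mE _ _ (E _)) !(mE' _ _ (E _)) !IH //= addSnnS.
Qed.

Section Extension.
Variable m : seq (int * bool) -> R.
Hypothesis cm : cyl_content m.

Let q u := m (code u).

Let q_ge0 u : 0 <= q u. Proof. by case: cm => _ + _ _; exact. Qed.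

Let qE u : q u = q (true :: u) + q (false :: u).
Proof. by case: cm => _ _ _; exact. Qed.

(** Nested subdivision of [0, 1[: the interval of [u] has length [m (code u)] and is cut at
    [threshold u], with [false] on the left and [true] on the right. *)
Fixpoint left_end u : R :=
  if u is b :: u' then left_end u' + (if b then m (code (false :: u')) else 0)
  else 0.

Definition threshold u := left_end u + m (code (false :: u)).

Fixpoint bits (w : R) (n : nat) : seq bool :=
  if n is n'.+1 then (threshold (bits w n') <= w) :: bits w n' else [::].

Lemma size_bits w n : size (bits w n) = n.
Proof. by elim: n => //= n ->. Qed.

Definition point_of (w : R) : full_shift :=
  fun i => threshold (bits w (zindex i)) <= w.

Let bits_itv w u : 0 <= w < 1 ->
  bits w (size u) = u <-> left_end u <= w < left_end u + q u.
Proof.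
move=> w01; elim: u => [|b u IH] /=.
  by split=> // _; rewrite add0r /q /=; case: cm => -> _ _ _.
have -> : (threshold (bits w (size u)) <= w) :: bits w (size u) = b :: u <->
    bits w (size u) = u /\ (threshold u <= w) = b.
  by split=> [[]|[-> ->]]// + uE; rewrite uE.
rewrite IH /threshold -/(q (false :: u)).
have := qE u; have := q_ge0 (true :: u); have := q_ge0 (false :: u).
case: b => q1 q2 q3; split.
- by move=> [H1 H2]; lra.
- by move=> H; split; lra.
- move=> [H1 /negbT]; rewrite -ltNge => H2; lra.
- by move=> H; split; [lra|apply/negbTE; rewrite -ltNge; lra].
Qed.

Let end_bounds u : 0 <= left_end u /\ left_end u + q u <= 1.
Proof.
elim: u => [|b u [IH1 IH2]] /=.
  by rewrite add0r /q /=; case: cm => -> _ _ _.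
have := qE u; have := q_ge0 (true :: u); have := q_ge0 (false :: u).
by rewrite -/(q (false :: u)); case: b => q1 q2 q3; split; lra.
Qed.

Let point_of_code w u : cyl (code u) (point_of w) <-> bits w (size u) = u.
Proof.
elim: u => [|b u IH] /=; first by rewrite cyl_nil.
rewrite cyl_cons/= /setI/= IH /point_of znthK.
by split=> [[<- uE]|[+ uE]]; rewrite uE.
Qed.

Let measurable_bits u : measurable ([set w : R | bits w (size u) = u] : set (measurableTypeR R)).
Proof.
elim: u => [|b u IH].
  by rewrite (_ : [set _ | _] = setT)//; apply/seteqP; split.
rewrite (_ : [set _ | _] =
    [set w | bits w (size u) = u] `&` [set w | (threshold u <= w) = b]).
  apply: measurableI => //.
  case: b; first by rewrite -set_itvcy; exact: measurable_itv.
  rewrite (_ : [set _ | _] = `]-oo, threshold u[%classic); first exact: measurable_itv.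
  apply/seteqP; split => w /=; rewrite in_itv/=; first by move=> /negbT; rewrite -ltNge.
  by rewrite ltNge => /negbTE.
apply/seteqP; split => w /=; first by move=> [+ uE]; rewrite uE.
by move=> [-> ->].
Qed.

Let measurable_point_of : measurable_fun [set: measurableTypeR R] point_of.
Proof.
apply: (measurability cyls measurable_full_shiftE).
move=> _ [_ [s _ <-] <-]; rewrite setTI.
elim: s => [|[i b] s IH].
  by rewrite cyl_nil preimage_setT.
rewrite cyl_cons preimage_setI; apply: measurableI => //=.
(* The letter at [i] depends only on the letters that precede it in the enumeration, a word with
   countably many possible values. *)
rewrite (_ : _ @^-1` _ = \bigcup_(u in [set: seq bool])
    (if size u == zindex i then [set w | bits w (size (b :: u)) = b :: u] else set0)).
  apply: countable_bigcupT_measurable; first exact: countableP.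
  move=> u; case: ifP => _; [exact: measurable_bits|exact: measurable0].
apply/seteqP; split=> w /=; rewrite /point_of.
  move=> wb; exists (bits w (zindex i)) => //.
  have := size_bits w (zindex i); case: eqP => // _ E.
  by rewrite /= E wb.
by move=> [u _]; case: eqP => //= -> [-> _].
Qed.

(* The law of [point_of w] for [w] uniform in [0, 1[: the points whose bits start
   with [u] fill an interval of length [m (code u)]. *)
Lemma cyl_content_extend :
  exists mu : probability full_shift R, forall s, mu (cyl s) = (m s)%:E.
Proof.
pose P : probability (measurableTypeR R) R := uniform_prob (@ltr01 R).
pose X : {RV P >-> full_shift} := HB.pack point_of
  (isMeasurableFun.Build _ _ (measurableTypeR R) full_shift point_of measurable_point_of).
pose mu : probability full_shift R := distribution P X.
exists mu => s.
suff <- : fine (mu (cyl s)) = m s.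
  by rewrite fineK// fin_num_measure//; exact: measurable_cyl.
apply: (eq_cyl_content (cyl_content_probability mu) cm) => u.
have [l0 l1] := end_bounds u.
have -> : mu (cyl (code u)) = P [set w | bits w (size u) = u].
  rewrite /mu /distribution /pushforward/=; congr uniform_prob.
  by apply/seteqP; split => w /= /point_of_code.
have PE a b : 0 <= a -> a <= b -> b <= 1 -> P `[a, b[%classic = (b - a)%:E.
  move=> a0 ab b1; rewrite /P /= /uniform_prob.
  rewrite (eq_integral (fun=> 1%:E)); last first.
    move=> w; rewrite inE/= in_itv/= => /andP[aw wb].
    by rewrite /uniform_pdf (le_trans a0 aw) (le_trans (ltW wb) b1) subr0 invr1.
  rewrite integral_cst//= mul1e lebesgue_measure_itv/= lte_fin.
  by case: ltgtP ab => // ->; rewrite subrr.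
have mS : measurable [set w : R | bits w (size u) = u] by exact: measurable_bits.
have mI : measurable (`[0, 1[%classic : set R) by exact: measurable_itv.
(* The description of the set as an interval holds inside [0, 1[ only; the rest of the line is null
   for the uniform law. *)
rewrite -(setIT [set w : R | _]) -(setvU `[0, 1[%classic) setIUr.
rewrite setUC measureU0/=; last 3 first.
- exact: measurableI.
- by apply: measurableI => //; exact: measurableC.
- apply/eqP; rewrite eq_le measure_ge0 andbT.
  apply: (@le_trans _ _ (P (~` `[0, 1[%classic))).
    apply: le_measure => //; rewrite inE; last exact: measurableC.
    by apply: measurableI => //; exact: measurableC.
  by rewrite [leLHS]probability_setC//= PE ?lexx// subr0 subee.
rewrite [X in P X](_ : _ = `[left_end u, left_end u + q u[%classic).
  rewrite PE ?lerDl ?q_ge0//.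
  by rewrite /= addrAC subrr add0r.
apply/seteqP; split => w /=; rewrite !in_itv/=.
  by move=> [wu w01]; exact/bits_itv.
move=> wu; have w01 : 0 <= w < 1 by lra.
by split => //; exact/bits_itv.
Qed.

End Extension.

End Contents.

(** * Limits along ultrafilters and weak compactness *)

Section UltrafilterLimits.
Variables (R : realType) (T : Type) (U : set_system T).
Hypothesis UU : UltraFilter U.

(** Compactness of the segment gives a cluster point, and a cluster point of an ultrafilter is a
    limit. *)
Lemma ultra_bounded_cvg (f : T -> R) (a b : R) :
  (forall t, a <= f t <= b) -> exists l : R, f t @[t --> U] --> l.
Proof.
move=> fab; have PF : ProperFilter (fmap f U) by exact: fmap_proper_filter.
have [l [_ cl]] : `[a, b] `&` cluster (f @ U) !=set0.
  apply: (@segment_compact R a b (fmap f U)).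
  rewrite /fmap /=; have : U setT by exact: filterT.
  apply: filterS => t _.
  by rewrite /= in_itv/=; exact: fab.
exists l => V /= Vl; case: (@in_ultra_setVsetC _ U (f @^-1` V) _) => // nV.
by have [x [nVx Vx]] := cl (~` V) V nV Vl.
Qed.

(** Weak compactness of the probabilities on the shift space: the limits taken cylinder by cylinder
    again form a content, which extends to a measure. *)
Lemma cyl_content_ultra (m : T -> seq (int * bool) -> R) :
  (forall t, cyl_content (m t)) ->
  exists mu : probability full_shift R,
    forall s, m t s @[t --> U] --> fine (mu (cyl s)).
Proof.
move=> cm.
have m01 t s : 0 <= m t s <= 1.
  case: (cm t) => m1 m0 _ mD; rewrite m0 /=; elim: s => [|[i b] s IH].
    by rewrite m1.
  apply: le_trans IH; rewrite [leRHS](mD _ i).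
  by case: b; rewrite ?lerDl ?lerDr m0.
have /choice[l ml] : forall s, exists l : R, m t s @[t --> U] --> l.
  by move=> s; exact: (@ultra_bounded_cvg _ 0 1).
have U_unique (a b : R) (f : T -> R) : f t @[t --> U] --> a -> f t @[t --> U] --> b -> a = b.
  by move=> fa fb; rewrite -(cvg_lim _ fa)// -(cvg_lim _ fb).
have [|mu muE] := @cyl_content_extend R l; last first.
  by exists mu => s; rewrite muE.
split.
- apply: U_unique (ml [::]) _.
  rewrite (_ : (fun t => m t [::]) = fun=> 1); first exact: cvg_cst.
  by apply/funext => t; case: (cm t).
- move=> s; apply: (cvgr_to_ge (ml s)); have : U setT by exact: filterT.
  by apply: filterS => t _; case/andP: (m01 t s).
- move=> s t st; apply: U_unique (ml s) _.
  rewrite (_ : (fun x => m x s) = fun x => m x t); first exact: ml.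
  by apply/funext => x; case: (cm x) => _ _ /(_ _ _ st).
- move=> s i; apply: U_unique (ml s) _.
  rewrite (_ : (fun t => m t s) =
    fun t => m t ((i, true) :: s) + m t ((i, false) :: s)).
    by apply: cvgD; exact: ml.
  by apply/funext => t; case: (cm t).
Qed.

End UltrafilterLimits.

(** * Translations and invariant measures *)

Section Shift.
Implicit Types (x : full_shift) (s : seq (int * bool)).

Definition translate (j : int) x : full_shift := fun i => x (i + j).

Definition translate_code (j : int) s := [seq (p.1 + j, p.2) | p <- s].

Lemma translate_cyl j s : translate j @^-1` cyl s = cyl (translate_code j s).
Proof.
by apply/seteqP; split => x; rewrite /cyl/= all_map.
Qed.

Lemma translate0 x : translate 0 x = x.
Proof. by apply/funext => i; rewrite /translate addr0. Qed.

Lemma shift_mapE : shift_map = translate 1.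
Proof. by []. Qed.

Lemma translateD j k x : translate j (translate k x) = translate (j + k) x.
Proof. by apply/funext => i; rewrite /translate addrA. Qed.

Lemma measurable_translate j : measurable_fun setT (translate j).
Proof.
apply: (measurability cyls measurable_full_shiftE).
by move=> _ [_ [s _ <-] <-]; rewrite setTI translate_cyl; exact: measurable_cyl.
Qed.

Lemma shift_invariant_cyl (R : realType) (mu : probability full_shift R) :
  (forall s, mu (cyl (translate_code 1 s)) = mu (cyl s)) -> shift_invariant mu.
Proof.
move=> mus A mA.
pose X : {RV mu >-> full_shift} := HB.pack (translate 1)
  (isMeasurableFun.Build _ _ full_shift full_shift (translate 1) (measurable_translate 1)).
pose nu : probability full_shift R := distribution mu X.
have : nu A = mu A.
  apply: eq_probability_cyl => // s.
  by rewrite -mus -translate_cyl.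
by [].
Qed.

Lemma shift_invariant_translate (R : realType) (mu : probability full_shift R) (n : nat) A :
  shift_invariant mu -> measurable A -> mu (translate n%:Z @^-1` A) = mu A.
Proof.
move=> imu; elim: n A => [|n IH] A mA.
  by congr (mu _); apply/seteqP; split => x; rewrite /preimage/= translate0.
have mS : measurable (shift_map @^-1` A).
  by rewrite -[X in measurable X]setTI; exact: (measurable_translate 1 measurableT mA).
rewrite -[RHS]imu// -(IH _ mS); congr (mu _).
by apply/seteqP; split => x; rewrite /preimage/= shift_mapE translateD intS.
Qed.

End Shift.

(** * Integrals of functions of finitely many coordinates *)

Section Expectation.
Variable R : realType.
Implicit Types (mu : probability full_shift R) (f : seq bool -> R).

Definition word_code (w : seq bool) : seq (int * bool) :=
  zip [seq k%:Z | k <- iota 1 (size w)] w.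

Lemma cyl_word_code x w : cyl (word_code w) x <-> prefix_word x (size w) = w.
Proof.
rewrite /word_code /prefix_word /cyl/=; elim: w (1%N) => [|b w IH] k //=.
by split=> [/andP[/eqP -> /IH ->]//|[-> /IH ->]]; rewrite eqxx.
Qed.

Lemma size_prefix_word x n : size (prefix_word x n) = n.
Proof. by rewrite size_map size_iota. Qed.

(** For [m] the measure of cylinders this is the integral of [f] over words of length [n]. A general
    [m] also covers evaluation at a point and empirical averages. *)
Definition word_sum (m : seq (int * bool) -> R) f n : R :=
  \sum_(w : n.-tuple bool) f w * m (word_code w).

Lemma prefix_word_sum f n x :
  f (prefix_word x n) = word_sum (fun s => \1_(cyl s) x) f n.
Proof.
have sp : size (prefix_word x n) == n by rewrite size_prefix_word.
rewrite /word_sum (bigD1 (Tuple sp))//= big1 => [|w wp]; rewrite indicE.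
  by rewrite mem_set ?mulr1 ?addr0//; apply/cyl_word_code; rewrite size_prefix_word.
rewrite memNset ?mulr0// => /cyl_word_code; rewrite size_tuple => wx.
by move/eqP: wp; apply; apply/val_inj.
Qed.

Lemma integrable_indic_sum mu (I : Type) (r : seq I) (a : I -> R) (A : I -> set full_shift) :
  (forall i, measurable (A i)) ->
  mu.-integrable setT (EFin \o (fun x => \sum_(i <- r) a i * \1_(A i) x)).
Proof.
move=> mA; rewrite (_ : _ \o _ =
    (fun x => \sum_(i <- r) (a i)%:E * (\1_(A i) x)%:E)%E); last first.
  by apply/funext => x /=; rewrite -sumEFin.
apply: integrable_sum => // i _; apply: integrableZl => //.
exact: integrable_indic.
Qed.

Lemma Rintegral_indic_sum mu (I : Type) (r : seq I) (a : I -> R) (A : I -> set full_shift) :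
  (forall i, measurable (A i)) ->
  \int[mu]_x (\sum_(i <- r) a i * \1_(A i) x) = \sum_(i <- r) a i * fine (mu (A i)).
Proof.
move=> mA; elim: r => [|i r IH].
  by under eq_Rintegral do rewrite big_nil; rewrite big_nil Rintegral_cst// mul0r.
under eq_Rintegral do rewrite big_cons.
have ii : mu.-integrable setT (EFin \o \1_(A i)) by exact: integrable_indic.
rewrite RintegralD//; last 2 first.
- rewrite (_ : (fun x => _) = (fun x => \sum_(j <- [:: i]) a j * \1_(A j) x)).
    exact: integrable_indic_sum.
  by apply/funext => x; rewrite big_seq1.
- exact: integrable_indic_sum.
rewrite big_cons IH RintegralZl//; congr (_ * _ + _).
by rewrite /Rintegral integral_indic// setIT.
Qed.

Lemma prefix_word_translate_sum f n j x :
  f (prefix_word (translate j x) n) =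
  \sum_(w : n.-tuple bool) f w * \1_(cyl (translate_code j (word_code w))) x.
Proof.
rewrite prefix_word_sum /word_sum; apply: eq_bigr => w _; congr (_ * _).
by rewrite -translate_cyl.
Qed.

Lemma integrable_prefix mu f n j :
  mu.-integrable setT (EFin \o (fun x => f (prefix_word (translate j x) n))).
Proof.
rewrite (_ : (fun x => _) = (fun x =>
    \sum_(w : n.-tuple bool) f w * \1_(cyl (translate_code j (word_code w))) x)).
  by apply: integrable_indic_sum => w; exact: measurable_cyl.
by apply/funext => x; exact: prefix_word_translate_sum.
Qed.

Lemma Rintegral_prefix mu f n :
  \int[mu]_x f (prefix_word x n) = word_sum (fun s => fine (mu (cyl s))) f n.
Proof.
under eq_Rintegral do rewrite prefix_word_sum /word_sum.
by rewrite Rintegral_indic_sum// => w; exact: measurable_cyl.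
Qed.

Lemma Rintegral_prefix_translate mu f n (k : nat) : shift_invariant mu ->
  \int[mu]_x f (prefix_word (translate k%:Z x) n) = \int[mu]_x f (prefix_word x n).
Proof.
move=> imu; under eq_Rintegral do rewrite prefix_word_translate_sum.
rewrite Rintegral_indic_sum; last by move=> w; exact: measurable_cyl.
rewrite Rintegral_prefix; apply: eq_bigr => w _; congr (_ * fine _).
by rewrite -translate_cyl shift_invariant_translate//; exact: measurable_cyl.
Qed.

(** A function of finitely many coordinates is a finite combination of indicators of cylinders, so
    convergence on cylinders suffices. *)
Lemma cvg_Rintegral_prefix (T : Type) (U : set_system T) (m : T -> seq (int * bool) -> R)
    mu f n : Filter U ->
  (forall s, m t s @[t --> U] --> fine (mu (cyl s))) ->
  word_sum (m t) f n @[t --> U] --> \int[mu]_x f (prefix_word x n).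
Proof.
move=> FU mmu; rewrite Rintegral_prefix /word_sum.
apply: cvg_big => [|w _]; first exact: add_continuous.
by apply: cvgZr => //; exact: mmu.
Qed.

End Expectation.

(** * Sums over windows and their growth rate *)

Section WindowSums.
Variable R : realType.
Implicit Types (c : int -> R) (n : nat) (i : int).

Definition bounded_seq c := exists B, forall i, `|c i| <= B.

Definition window c i n : R := \sum_(k < n) c (i + k%:Z).

Definition window_sup c n : R := sup [set window c i n | i in [set: int]].

(** By subadditivity the infimum is also the limit of the averages. This form yields the bound
    [growth_le] at every length. *)
Definition growth c : R := inf [set window_sup c n.+1 / n.+1%:R | n in [set: nat]].

Lemma window_add c i n k : window c i (n + k) = window c i n + window c (i + n%:Z) k.
Proof.
rewrite /window big_split_ord/=; congr (_ + _).
by apply: eq_bigr => j _; rewrite PoszD addrA.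
Qed.

Lemma window_bound c B i n : (forall i, `|c i| <= B) -> `|window c i n| <= n%:R * B.
Proof.
move=> cB; apply: (le_trans (ler_norm_sum _ _ _)).
apply: (@le_trans _ _ (\sum_(k < n) B)); first exact: ler_sum.
by rewrite sumr_const card_ord mulr_natl.
Qed.

Lemma window_has_sup c n : bounded_seq c -> has_sup [set window c i n | i in [set: int]].
Proof.
move=> [B cB]; split; first by exists (window c 0 n), 0.
exists (n%:R * B) => _ [i _ <-].
exact: le_trans (ler_norm _) (window_bound _ _ cB).
Qed.

Lemma window_sup_ub c i n : bounded_seq c -> window c i n <= window_sup c n.
Proof.
by move=> bc; apply: sup_ubound; [exact: (window_has_sup n bc).2|exists i].
Qed.

Lemma window_sup_le c n (M : R) : (forall i, window c i n <= M) -> window_sup c n <= M.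
Proof.
move=> cM; apply: ge_sup; first by exists (window c 0 n), 0.
by move=> _ [i _ <-].
Qed.

Lemma window_sup_add c n k : bounded_seq c ->
  window_sup c (n + k) <= window_sup c n + window_sup c k.
Proof.
move=> bc; apply: window_sup_le => i; rewrite window_add.
by apply: lerD; exact: window_sup_ub.
Qed.

Lemma window_sup_mul c n k : bounded_seq c ->
  window_sup c (k * n) <= k%:R * window_sup c n.
Proof.
move=> bc; elim: k => [|k IH].
  by rewrite mul0n mul0r; apply: window_sup_le => i; rewrite /window big_ord0.
rewrite mulSn (le_trans (window_sup_add _ _ bc))// -nat1r mulrDl mul1r.
by rewrite lerD2l.
Qed.

Lemma window_sup_ge c B n : (forall i, `|c i| <= B) -> - (n%:R * B) <= window_sup c n.
Proof.
move=> cB; apply: le_trans (window_sup_ub 0 n _); last by exists B.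
by have := window_bound 0 n cB; rewrite ler_norml => /andP[].
Qed.

Lemma growth_has_inf c : bounded_seq c ->
  has_inf [set window_sup c n.+1 / n.+1%:R | n in [set: nat]].
Proof.
move=> [B cB]; split; first by exists (window_sup c 1 / 1), 0%N.
exists (- B) => _ [n _ <-]; rewrite ler_pdivlMr ?ltr0n//.
by apply: le_trans (window_sup_ge _ cB); rewrite mulNr mulrC.
Qed.

Lemma growth_le c n : bounded_seq c -> n%:R * growth c <= window_sup c n.
Proof.
move=> bc; case: n => [|n].
  by rewrite mul0r; apply: le_trans (window_sup_ub 0 0 bc); rewrite /window big_ord0.
rewrite mulrC -ler_pdivlMr ?ltr0n//.
by apply: inf_lbound; [exact: (growth_has_inf bc).2|exists n].
Qed.

(** Fekete's argument: cut a long window into blocks of a length [q] whose average is nearly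
    minimal, plus a remainder shorter than [q]. *)
Lemma growth_cvg c : bounded_seq c ->
  (fun n : nat => n%:R^-1 * window_sup c n) @ \oo --> growth c.
Proof.
move=> bc; have [B cB] := bc.
have B0 : 0 <= B by apply: le_trans (cB 0).
apply/cvgrPdist_le => e e0.
have e20 : 0 < e / 2 by rewrite divr_gt0.
have [_ [p _ <-] pe] := inf_adherent e20 (growth_has_inf bc).
set q := p.+1 in pe; rewrite -/(growth c) in pe.
have q0 : 0 < q%:R :> R by rewrite ltr0n.
near=> n.
have n0 : 0 < n%:R :> R by rewrite ltr0n; near: n; exists 1%N.
rewrite ler_distlC; apply/andP; split.
  have : growth c <= n%:R^-1 * window_sup c n by rewrite ler_pdivlMl// growth_le.
  lra.
rewrite ler_pdivrMl// {1}(divn_eq n q).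
apply: (le_trans (window_sup_add _ _ bc)).
apply: (@le_trans _ _ ((n %/ q)%:R * (q%:R * (growth c + e / 2)) + q%:R * B)).
  apply: lerD.
    apply: (le_trans (window_sup_mul _ _ bc)); rewrite ler_wpM2l//.
    by rewrite mulrC -ler_pdivrMr// ltW.
  apply: window_sup_le => i; apply: le_trans (ler_norm _) _.
  apply: le_trans (window_bound _ _ cB) _; rewrite ler_wpM2r// ler_nat.
  by rewrite ltnW// ltn_pmod.
have -> : (n %/ q)%:R * (q%:R * (growth c + e / 2)) =
   (n%:R - (n %% q)%:R) * (growth c + e / 2).
  by rewrite [in n%:R](divn_eq n q) natrD natrM; ring.
have gB : - B <= growth c.
  apply: lb_le_inf; first exact: (growth_has_inf bc).1.
  move=> _ [k _ <-]; rewrite ler_pdivlMr ?ltr0n//.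
  by apply: le_trans (window_sup_ge _ cB); rewrite mulNr mulrC.
(* Two errors of at most [q * B] each, from the remaining block and from the multiple of the growth
   rate lost to the remainder, must fit into [n * e / 2]. *)
have ne : 4 * q%:R * B / e <= n%:R by near: n; exact: nbhs_infty_ger.
rewrite ler_pdivrMr// in ne.
have rq : (n %% q)%:R <= q%:R :> R by rewrite ler_nat ltnW// ltn_pmod.
have r0 : 0 <= (n %% q)%:R :> R by [].
nra.
Unshelve. all: by end_near. Qed.

Lemma growth_lip c c' d : bounded_seq c -> bounded_seq c' ->
  (forall i, c i <= c' i + d) -> growth c <= growth c' + d.
Proof.
move=> bc bc' cd; rewrite -lerBlDr; apply: lb_le_inf; first exact: (growth_has_inf bc').1.
move=> _ [n _ <-]; rewrite ler_pdivlMr ?ltr0n// mulrC mulrBr lerBlDr.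
apply: (le_trans (growth_le n.+1 bc)); apply: window_sup_le => i.
apply: (@le_trans _ _ (window c' i n.+1 + n.+1%:R * d)); last first.
  by rewrite lerD2r window_sup_ub.
have -> : n.+1%:R * d = \sum_(k < n.+1) d by rewrite sumr_const card_ord mulr_natl.
rewrite -big_split/=.
exact: ler_sum.
Qed.

End WindowSums.

(** * Weights summed along words *)

Section WordSums.
Variable R : realType.
Implicit Types (a : bool -> int -> R) (w : seq bool).

Definition bounded_weights a := exists B, forall b i, `|a b i| <= B.

Definition weight_sum a w i : R := \sum_(k < size w) a (nth false w k) (i + k%:Z).

Definition weight_sup a w : R := sup [set weight_sum a w i | i in [set: int]].

Definition best a i : bool := a false i <= a true i.

Definition peak a i : R := a (best a i) i.

Lemma le_peak a b i : a b i <= peak a i.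
Proof. by rewrite /peak /best; case: (leP (a false i)) => h; case: b => //; exact: ltW. Qed.

Lemma bounded_peak a : bounded_weights a -> bounded_seq (peak a).
Proof. by move=> [B aB]; exists B => i; exact: aB. Qed.

Lemma weight_sum_bound a B w i : (forall b i, `|a b i| <= B) ->
  `|weight_sum a w i| <= (size w)%:R * B.
Proof.
move=> cB; apply: (le_trans (ler_norm_sum _ _ _)).
apply: (@le_trans _ _ (\sum_(k < size w) B)); first exact: ler_sum.
by rewrite sumr_const card_ord mulr_natl.
Qed.

Lemma weight_sup_ub a w i : bounded_weights a -> weight_sum a w i <= weight_sup a w.
Proof.
move=> [B aB]; apply: sup_ubound; last by exists i.
exists ((size w)%:R * B) => _ [j _ <-].
exact: le_trans (ler_norm _) (weight_sum_bound _ _ aB).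
Qed.

Lemma weight_sup_le a w (M : R) : (forall i, weight_sum a w i <= M) -> weight_sup a w <= M.
Proof.
move=> cM; apply: ge_sup; first by exists (weight_sum a w 0), 0.
by move=> _ [i _ <-].
Qed.

Lemma weight_sum_cat a w w' i :
  weight_sum a (w ++ w') i = weight_sum a w i + weight_sum a w' (i + (size w)%:Z).
Proof.
rewrite /weight_sum size_cat big_split_ord/=; congr (_ + _); apply: eq_bigr => k _.
  by rewrite nth_cat ltn_ord.
by rewrite nth_cat ltnNge leq_addr/= addKn PoszD addrA.
Qed.

Lemma weight_sup_cat a w w' : bounded_weights a ->
  weight_sup a (w ++ w') <= weight_sup a w + weight_sup a w'.
Proof.
move=> ba; apply: weight_sup_le => i; rewrite weight_sum_cat.
by apply: lerD; exact: weight_sup_ub.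
Qed.

Lemma weight_sup_le_window a w : bounded_weights a ->
  weight_sup a w <= window_sup (peak a) (size w).
Proof.
move=> ba; apply: weight_sup_le => i.
apply: le_trans (window_sup_ub i _ (bounded_peak ba)).
by apply: ler_sum => k _; exact: le_peak.
Qed.

Lemma weight_sup_lip a a' d w : bounded_weights a' ->
  (forall b i, a b i <= a' b i + d) -> weight_sup a w <= weight_sup a' w + (size w)%:R * d.
Proof.
move=> ba' ad; apply: weight_sup_le => i.
apply: le_trans (_ : weight_sum a' w i + (size w)%:R * d <= _); last first.
  by rewrite lerD2r weight_sup_ub.
have -> : (size w)%:R * d = \sum_(k < size w) d.
  by rewrite sumr_const card_ord mulr_natl.
rewrite -big_split/=.
exact: ler_sum.
Qed.

Lemma weight_sum_best a i n :
  weight_sum a [seq best a (i + k%:Z) | k <- iota 0 n] i = window (peak a) i n.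
Proof.
rewrite /weight_sum /window size_map size_iota; apply: eq_bigr => k _.
by rewrite (nth_map 0%N) ?size_iota// nth_iota.
Qed.

End WordSums.

(** * Optimal measures: existence and stability under limits *)

Section OptimalMeasures.
Variable R : realType.
Implicit Types (a : bool -> int -> R) (mu : probability full_shift R).

(* By subadditivity the integral condition is equivalent to convergence of the
   normalised integrals to [growth (peak a)], but it passes to weak limits. *)
Definition optimal a mu := shift_invariant mu /\
  forall n : nat, n%:R * growth (peak a) <= \int[mu]_x weight_sup a (prefix_word x n).

Lemma prefix_word_cat x n k :
  prefix_word x (n + k) = prefix_word x n ++ prefix_word (translate n%:Z x) k.
Proof.
rewrite /prefix_word iotaD map_cat; congr (_ ++ _).
rewrite [(1 + n)%N]addnC iotaDl -map_comp; apply: eq_map => j /=.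
by rewrite /translate PoszD addrC.
Qed.

Lemma integrable_weight_sup mu a n :
  mu.-integrable setT (EFin \o (fun x => weight_sup a (prefix_word x n))).
Proof.
have := integrable_prefix mu (weight_sup a) n 0.
by under [X in _ \o X]eq_fun do rewrite translate0.
Qed.

Lemma integral_cst_probability mu (r : R) : \int[mu]_x r = r.
Proof.
have /= -> := @Rintegral_cst _ _ R mu setT measurableT r.
by rewrite probability_setT mulr1.
Qed.

Lemma le_integral_weight_sup mu a n :  bounded_weights a ->
  \int[mu]_x weight_sup a (prefix_word x n) <= window_sup (peak a) n.
Proof.
move=> ba; rewrite -[leRHS](integral_cst_probability mu); apply: le_Rintegral => //.
- exact: integrable_weight_sup.
- by apply: finite_measure_integrable_cst.
- by move=> x _; rewrite -{2}(size_prefix_word x n); exact: weight_sup_le_window.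
Qed.

Lemma integrable_EFinD mu (f g : full_shift -> R) :
  mu.-integrable setT (EFin \o f) -> mu.-integrable setT (EFin \o g) ->
  mu.-integrable setT (EFin \o (fun x => f x + g x)).
Proof. by move=> fi gi; exact: (integrableD measurableT fi gi). Qed.

Lemma integral_weight_sup_add mu a n k : bounded_weights a -> shift_invariant mu ->
  \int[mu]_x weight_sup a (prefix_word x (n + k)) <=
  \int[mu]_x weight_sup a (prefix_word x n) + \int[mu]_x weight_sup a (prefix_word x k).
Proof.
move=> ba imu.
rewrite -(Rintegral_prefix_translate (weight_sup a) k n imu) -RintegralD//; last 2 first.
- exact: integrable_weight_sup.
- exact: integrable_prefix.
apply: le_Rintegral => //.
- exact: integrable_weight_sup.
- apply: integrable_EFinD; last exact: integrable_prefix.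
  exact: integrable_weight_sup.
- by move=> x _; rewrite prefix_word_cat weight_sup_cat.
Qed.

Lemma integral_weight_sup_mul mu a n k : bounded_weights a -> shift_invariant mu ->
  \int[mu]_x weight_sup a (prefix_word x (k.+1 * n)) <=
  k.+1%:R * \int[mu]_x weight_sup a (prefix_word x n).
Proof.
move=> ba imu; elim: k => [|k IH]; first by rewrite mul1n mul1r.
rewrite mulSn (le_trans (integral_weight_sup_add _ _ ba imu))//.
by rewrite -[k.+2%:R]nat1r mulrDl mul1r lerD2l.
Qed.

(** The inequalities of [optimal] and the bound by [window_sup] squeeze the averages. Conversely, by
    subadditivity the average at a length dominates those at its multiples, which tend to the growth
    rate. *)
Lemma optimalP a mu : bounded_weights a ->
  optimal a mu <-> shift_invariant mu /\
  (fun n : nat => n%:R^-1 * \int[mu]_x weight_sup a (prefix_word x n)) @ \oo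
    --> growth (peak a).
Proof.
move=> ba; split=> -[imu H]; split=> //.
  apply: (@squeeze_cvgr _ _ _ _ (fun=> growth (peak a)) (fun n => n%:R^-1 * window_sup (peak a) n)).
  - near=> n.
    have n0 : 0 < n%:R :> R by rewrite ltr0n; near: n; exists 1%N.
    rewrite ler_pdivlMl// H/= ler_pM2l ?invr_gt0//.
    exact: le_integral_weight_sup.
  - exact: cvg_cst.
  - exact/growth_cvg/bounded_peak.
case=> [|n].
  rewrite mul0r; apply: Rintegral_ge0 => x _.
  apply: le_trans (weight_sup_ub _ 0 ba); rewrite /weight_sum big_ord0//.
rewrite -ler_pdivlMl ?ltr0n//; apply/ler_addgt0Pr => e e0.
have /cvgrPdist_le/(_ e e0)[N _ HN] := H.
have /HN : (N <= N.+1 * n.+1)%N by lia.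
rewrite /= ler_distlC => /andP[+ _]; rewrite lerBlDr => /le_trans; apply.
rewrite lerD2r ler_pdivrMl ?ltr0n ?muln_gt0//.
apply: le_trans (integral_weight_sup_mul _ _ ba imu) _.
rewrite natrM -mulrA ler_wpM2l// mulrA divff ?mul1r// pnatr_eq0.
Unshelve. all: by end_near. Qed.

Lemma cyl_content_average (x : nat -> full_shift) (n : nat) :
  cyl_content (fun s => n.+1%:R^-1 * \sum_(k < n.+1) \1_(cyl s) (x k) : R).
Proof.
split.
- rewrite (eq_bigr (fun=> 1)) => [|k _]; last by rewrite cyl_nil indicT.
  by rewrite sumr_const card_ord mulVf.
- by move=> s; rewrite mulr_ge0// sumr_ge0.
- by move=> s t ->.
- move=> s i; rewrite -mulrDr -big_split/=; congr (_ * _); apply: eq_bigr => k _.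
  have mem_cyl t : (x k \in cyl t) = all (fun p => x k p.1 == p.2) t.
    by apply/idP/idP; rewrite inE.
  by rewrite !indicE !mem_cyl /=; case: (x k i); rewrite ?addr0 ?add0r.
Qed.

Lemma window_double_sum (c : int -> R) i n N :
  \sum_(k < n) window c (i + k%:Z) N = \sum_(j < N) window c (i + j%:Z) n.
Proof.
rewrite /window exchange_big/=; apply: eq_bigr => j _; apply: eq_bigr => k _.
by rewrite addrAC.
Qed.

Lemma window_translate_ge (c : int -> R) B i n j : (forall i, `|c i| <= B) ->
  window c i n - 2 * j%:R * B <= window c (i + j%:Z) n.
Proof.
move=> cB; have := window_bound i j cB; have := window_bound (i + n%:Z) j cB.
have := window_add c i n j; have := window_add c i j n; rewrite addnC => -> H.
by rewrite !ler_norml => /andP[h1 h2] /andP[h3 h4]; lra.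
Qed.

(* Empirical measures of [best a] along windows of nearly maximal sum. *)
Lemma exists_optimal a : bounded_weights a -> exists mu, optimal a mu.
Proof.
move=> ba; have bp := bounded_peak ba; have [B pB] := bp.
have B0 : 0 <= B by apply: le_trans (pB 0).
set c := peak a in bp pB *; pose g := growth c.
have /choice[i iE] : forall n, exists i, n.+1%:R * g - 1 <= window c i n.+1.
  move=> n; have [_ [i _ <-] h] := sup_adherent (@ltr01 R) (window_has_sup n.+1 bp).
  by exists i; apply: le_trans (ltW h); rewrite lerD2r; exact: growth_le.
pose xs : full_shift := best a.
(* Words are read from the coordinate 1; subtracting 1 makes those of [x n k] start at the site
   [i n + k]. *)
pose x n k := translate (i n + k%:Z - 1) xs.
pose m n s : R := n.+1%:R^-1 * \sum_(k < n.+1) \1_(cyl s) (x n k).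
have [U [UU oU]] := ultraFilterLemma (_ : ProperFilter \oo).
have [mu mE] := cyl_content_ultra UU (fun n => @cyl_content_average (x n) n).
exists mu; split.
  apply: shift_invariant_cyl => s.
  suff E : fine (mu (cyl (translate_code 1 s))) = fine (mu (cyl s)).
    by rewrite -[LHS]fineK ?fin_num_measure ?E ?fineK ?fin_num_measure//; exact: measurable_cyl.
  apply/eqP; rewrite -subr_eq0; apply/eqP.
  rewrite -(cvg_lim _ (cvgB (mE (translate_code 1 s)) (mE s)))//.
  apply: cvg_lim => //; apply: cvg_trans; first exact: cvg_app oU.
  apply/cvgr0Pnorm_le => e e0.
  have /cvgr0_norm_le/(_ e e0) := @cvg_harmonic R.
  apply: filterS => n; apply: le_trans.
  rewrite -mulrBr normrM /harmonic ler_piMr//.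
  rewrite !fctE; pose y k : R := \1_(cyl s) (x n k).
  (* The shift sends each sample point to the next one, so the difference telescopes to two
     indicators and is at most 1 before division by [n.+1]. *)
  rewrite -sumrB (eq_bigr (fun k : 'I_n.+1 => y k.+1 - y k)); last first.
    move=> k _; congr (_ - _); rewrite /y -translate_cyl.
    have -> : x n k.+1 = translate 1 (x n k).
      rewrite /x translateD (_ : i n + k.+1%:Z - 1 = 1 + (i n + k%:Z - 1))//.
      by rewrite intS; ring.
    rewrite !indicE; have [h|h] := pselect (cyl s (translate 1 (x n k))).
      by rewrite !mem_set.
    by rewrite !memNset.
  rewrite -(big_mkord xpredT (fun k => y k.+1 - y k)) telescope_sumr//.
  rewrite /y !indicE; case: (_ \in _); case: (_ \in _); rewrite ?subrr ?subr0 ?sub0r ?normrN ?normr1 ?normr0//.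
move=> N; have := @cvg_Rintegral_prefix R nat U m mu (weight_sup a) N (@ultra_proper _ _ UU) mE.
suff H n : N%:R * (g - (1 + 2 * N%:R * B) / n.+1%:R) <= word_sum (m n) (weight_sup a) N.
  move=> mN.
  have fN : (fun n => N%:R * (g - (1 + 2 * N%:R * B) / n.+1%:R)) @ U -->
      N%:R * (g - (1 + 2 * N%:R * B) * 0).
    apply: cvg_trans; first exact: cvg_app oU.
    apply: cvgMr; apply: cvgB; first exact: cvg_cst.
    by apply: cvgMr; exact: cvg_harmonic.
  rewrite mulr0 subr0 in fN; apply: ler_cvg_to fN mN _.
  by have : U setT by [exact: filterT]; apply: filterS => n _; exact: H.
have -> : word_sum (m n) (weight_sup a) N =
    n.+1%:R^-1 * \sum_(k < n.+1) weight_sup a (prefix_word (x n k) N).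
  rewrite /word_sum mulr_sumr.
  under [RHS]eq_bigr do rewrite prefix_word_sum /word_sum mulr_sumr.
  rewrite exchange_big/=; apply: eq_bigr => w _.
  rewrite /m mulrCA !mulr_sumr; by apply: eq_bigr => k _; rewrite mulrCA.
rewrite ler_pdivlMl ?ltr0n//.
apply: (@le_trans _ _ (\sum_(k < n.+1) window c (i n + k%:Z) N)); last first.
  apply: ler_sum => k _; rewrite -weight_sum_best.
  rewrite (_ : [seq _ | _ <- _] = prefix_word (x n k) N); first exact: weight_sup_ub.
  rewrite /prefix_word -[1%N]/(1 + 0)%N iotaDl -map_comp; apply: eq_map => j /=.
  by rewrite /x /translate /xs PoszD; congr (best a _); ring.
(* After the exchange of sums there are [N] windows of length [n.+1], each displaced by less than
   [N] from a nearly maximal one, which costs at most [2 * N * B]. *)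
rewrite window_double_sum.
apply: (@le_trans _ _ (\sum_(j < N) (n.+1%:R * g - 1 - 2 * N%:R * B))).
  rewrite sumr_const card_ord -[leRHS]mulr_natl mulrCA ler_wpM2l//.
  by rewrite mulrBr mulrCA divff ?pnatr_eq0// mulr1 opprD addrA.
apply: ler_sum => j _; apply: le_trans (window_translate_ge _ _ _ pB).
apply: lerB; first exact: iE.
by rewrite ler_wpM2r// ler_wpM2l// ler_nat ltnW.
Qed.

(** For fixed [n] the integrand depends on [n] coordinates and is Lipschitz in the weights, and the
    growth rate is Lipschitz too, so each inequality of [optimal] survives in the limit. *)
Lemma optimal_ultra (T : Type) (U : set_system T) (a_ : T -> bool -> int -> R)
    (mu_ : T -> probability full_shift R) a mu : UltraFilter U ->
  bounded_weights a -> (forall t, bounded_weights (a_ t)) ->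
  (forall e, 0 < e -> \forall t \near U, forall b i, `|a_ t b i - a b i| <= e) ->
  (forall t, optimal (a_ t) (mu_ t)) ->
  (forall s, fine (mu_ t (cyl s)) @[t --> U] --> fine (mu (cyl s))) ->
  optimal a mu.
Proof.
move=> UU ba bat ata ot mu_mu.
split.
  apply: shift_invariant_cyl => s.
  have E : fine (mu (cyl (translate_code 1 s))) = fine (mu (cyl s)).
    have := mu_mu (translate_code 1 s).
    rewrite (_ : (fun t => _) = (fun t => fine (mu_ t (cyl s)))); last first.
      apply/funext => t; have [/(_ _ (measurable_cyl s)) <- _] := ot t.
      by rewrite -translate_cyl.
    by move=> h; rewrite -(cvg_lim _ (mu_mu s))// -(cvg_lim _ h).
  by rewrite -[LHS]fineK ?fin_num_measure ?E ?fineK ?fin_num_measure//; exact: measurable_cyl.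
move=> n; apply/ler_addgt0Pr => e e0.
(* The integral and [n] times the growth rate each move by at most [n * d], hence by at most
   [e / 2]; the successor allows [n = 0]. *)
pose d := e / (2 * n.+1%:R).
have d0 : 0 < d by rewrite divr_gt0// mulr_gt0.
have h := @cvg_Rintegral_prefix R T U _ mu (weight_sup a) n (@ultra_proper _ _ UU) mu_mu.
apply: (cvgr_to_ge (cvgD h (cvg_cst e))).
apply: filterS (ata _ d0) => t atd.
rewrite fctE -Rintegral_prefix.
have [imt /(_ n) ot2] := ot t.
have [at1 at2] : (forall b i, a b i <= a_ t b i + d) /\ (forall b i, a_ t b i <= a b i + d).
  by split=> b i; have := atd b i; rewrite ler_norml => /andP[]; lra.
have g1 : growth (peak a) <= growth (peak (a_ t)) + d.
  apply: growth_lip => [||i]; try exact: bounded_peak.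
  by rewrite {1}/peak (le_trans (at1 _ _))// lerD2r le_peak.
have g2 : \int[mu_ t]_x weight_sup (a_ t) (prefix_word x n) <=
    \int[mu_ t]_x weight_sup a (prefix_word x n) + n%:R * d.
  rewrite -[X in _ <= _ + X](integral_cst_probability (mu_ t)) -RintegralD//; last 2 first.
  - exact: integrable_weight_sup.
  - exact: finite_measure_integrable_cst.
  apply: le_Rintegral => //.
  - exact: integrable_weight_sup.
  - apply: integrable_EFinD; first exact: integrable_weight_sup.
    exact: finite_measure_integrable_cst.
  - move=> x _; rewrite -{3}(size_prefix_word x n); exact: weight_sup_lip.
have nd : n%:R * d <= e / 2.
  have <- : n.+1%:R * d = e / 2 by rewrite /d; field; rewrite addrC natr1 pnatr_eq0.
  by rewrite ler_wpM2r ?ler_nat// ltW.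
have n0 : 0 <= n%:R :> R by [].
have : n%:R * growth (peak a) <= n%:R * (growth (peak (a_ t)) + d) by rewrite ler_wpM2l.
rewrite mulrDr; lra.
Qed.

End OptimalMeasures.

(** * Small second differences in countably many directions *)

Section GenericPerturbation.
Variable R : realType.
Variable h : (int -> R) -> R.
Hypothesis h_lip : forall c c' d, bounded_seq c -> bounded_seq c' ->
  (forall i, c i <= c' i + d) -> h c <= h c' + d.

Definition second_difference (c g : int -> R) (s : R) : R :=
  h (fun i => c i + s * g i) + h (fun i => c i - s * g i) - 2 * h c.

Lemma bounded_seqD (c g : int -> R) (s : R) : bounded_seq c -> (forall i, 0 <= g i <= 1) ->
  bounded_seq (fun i => c i + s * g i).
Proof.
move=> [B cB] g01; exists (B + `|s|) => i.
apply: le_trans (ler_normD _ _) _; apply: lerD; first exact: cB.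
by have /andP[g0 g1] := g01 i; rewrite normrM (ger0_norm g0) ler_piMr.
Qed.

(* A Lipschitz function of one variable has a small second difference at some
   point of any interval: otherwise its increments would grow linearly. *)
Lemma small_second_difference (c g : int -> R) (kappa eta : R) :
  bounded_seq c -> (forall i, 0 <= g i <= 1) -> 0 < kappa -> 0 < eta ->
  exists t s, [/\ 0 <= t <= kappa, 0 < s &
    second_difference (fun i => c i + t * g i) g s <= eta * s].
Proof.
move=> bc g01 k0 eta0.
pose f t := h (fun i => c i + t * g i).
have flip t t' : t <= t' -> `|f t' - f t| <= t' - t.
  move=> tt'; rewrite ler_norml; apply/andP; split.
    rewrite lerBrDr addrC lerBlDr; apply: h_lip; try exact: bounded_seqD.
    by move=> i; have /andP[? ?] := g01 i; nra.
  rewrite lerBlDr addrC; apply: h_lip; try exact: bounded_seqD.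
  by move=> i; have /andP[? ?] := g01 i; nra.
(* If the second differences at [N] consecutive grid points all exceeded [eta * s], the last
   increment would exceed the first by more than [2 * s], whereas each is at most [s] in absolute
   value. *)
pose N := (Num.bound (2 / eta)).
have N2 : 2 / eta < N%:R by apply: archi_boundP; rewrite divr_ge0 ?ltW.
pose s := kappa / N.+1%:R.
have s0 : 0 < s by rewrite divr_gt0.
have sk : N.+1%:R * s = kappa by rewrite /s mulrCA divff ?mulr1// pnatr_eq0.
apply: contrapT => H.
have Hj j : (j < N)%N -> eta * s < f (j.+2%:R * s) - f (j.+1%:R * s) - (f (j.+1%:R * s) - f (j%:R * s)).
  move=> jN; rewrite ltNge; apply/negP => Hle; apply: H.
  exists (j.+1%:R * s), s; split => //.
    apply/andP; split; first by rewrite mulr_ge0// ltW.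
    by rewrite -[leRHS]sk ler_wpM2r ?(ltW s0)// ler_nat ltnS ltnW.
  rewrite /second_difference; apply: le_trans Hle.
  rewrite (_ : (fun i => _) = (fun i => c i + j.+2%:R * s * g i)); last first.
    by apply/funext => i; rewrite -[j.+2%:R]natr1; ring.
  rewrite (_ : (fun i => _ - _) = (fun i => c i + j%:R * s * g i)); last first.
    by apply/funext => i; rewrite -[j.+1%:R]natr1; ring.
  by rewrite -/(f _) -/(f _) -/(f _); lra.
have Hsum j : (j <= N)%N -> j%:R * (eta * s) <= f (j.+1%:R * s) - f (j%:R * s) - (f s - f 0).
  elim: j => [_|j IH jN]; first by rewrite !mul0r mul1r; lra.
  rewrite -[j.+1%:R in leLHS]natr1 mulrDl mul1r.
  by have := Hj j jN; have := IH (ltnW jN); lra.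
have := Hsum N (leqnn _).
have h1 : `|f (N.+1%:R * s) - f (N%:R * s)| <= s.
  by apply: le_trans (flip _ _ _) _; rewrite -[N.+1%:R]natr1 mulrDl mul1r; lra.
have h2 : `|f s - f 0| <= s by apply: le_trans (flip _ _ (ltW s0)) _; rewrite subr0.
move: h1 h2; rewrite !ler_norml => /andP[_ h1] /andP[h2 _].
rewrite ltr_pdivrMr// in N2.
have : 2 * s < N%:R * (eta * s) by rewrite mulrA ltr_pM2r.
by lra.
Qed.

(** Treat the directions one after the other. Once the direction [k] has a small second difference
    at some scale [s], all later changes together are kept so small compared with [s] that the
    Lipschitz bound preserves it; the increasing sequence of perturbations has the required
    limit. *)
Lemma generic_perturbation (g : nat -> int -> R) (eta : nat -> R) (c0 : int -> R) (kappa0 : R) :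
  (forall k i, 0 <= g k i <= 1) -> (forall k, 0 < eta k) ->
  bounded_seq c0 -> 0 < kappa0 ->
  exists c, [/\ bounded_seq c, forall i, c0 i <= c i <= c0 i + kappa0 &
    forall k, exists2 s, 0 < s & second_difference c (g k) s <= eta k * s].
Proof.
move=> g01 eta0 bc0 kappa00.
(* The state is a pair: the current sequence and the room above it in which all later sequences must
   stay. These ranges are nested. *)
have /choice[step stepP] : forall kck : nat * ((int -> R) * R), exists ck : ((int -> R) * R),
    bounded_seq kck.2.1 -> 0 < kck.2.2 -> [/\ bounded_seq ck.1, 0 < ck.2,
      forall i, kck.2.1 i <= ck.1 i, forall i, ck.1 i + ck.2 <= kck.2.1 i + kck.2.2 &
      exists s, [/\ 0 < s, second_difference ck.1 (g kck.1) s <= eta kck.1 / 2 * s &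
        4 * ck.2 <= eta kck.1 / 2 * s]].
  move=> [k [c kappa]] /=.
  have [bc|] := pselect (bounded_seq c); last by exists (c, kappa).
  have [k0|] := pselect (0 < kappa); last by exists (c, kappa).
  have k20 : 0 < kappa / 2 by rewrite divr_gt0.
  have e20 : 0 < eta k / 2 by rewrite divr_gt0.
  have [t [s [/andP[t0 tk] s0 H]]] := small_second_difference bc (g01 k) k20 e20.
  (* The step itself uses at most half of the room, so [kappa / 2] keeps the new range inside the
     old one. The bound [eta k * s / 8] limits the effect of later changes on the second difference
     to [eta k * s / 2]. *)
  exists (fun i => c i + t * g k i, Num.min (kappa / 2) (eta k * s / 8)) => _ _ /=.
  have m1 : Num.min (kappa / 2) (eta k * s / 8) <= kappa / 2 by rewrite ge_min lexx.
  have m2 : Num.min (kappa / 2) (eta k * s / 8) <= eta k * s / 8 by rewrite ge_min lexx orbT.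
  split.
  - exact: bounded_seqD.
  - by rewrite lt_min k20 divr_gt0// mulr_gt0.
  - by move=> i; have /andP[? ?] := g01 k i; nra.
  - by move=> i; have /andP[? ?] := g01 k i; nra.
  - by exists s; split => //; lra.
pose st := fix st k := if k is k'.+1 then step (k', st k') else (c0, kappa0).
have stP k : bounded_seq (st k).1 /\ 0 < (st k).2.
  by elim: k => [//|k [h1 h2]]; have [] := stepP (k, st k) h1 h2.
have stS k := stepP (k, st k) (stP k).1 (stP k).2.
have mono i k l : (k <= l)%N ->
    (st k).1 i <= (st l).1 i /\ (st l).1 i + (st l).2 <= (st k).1 i + (st k).2.
  elim: l => [|l IH]; first by rewrite leqn0 => /eqP ->.
  rewrite leq_eqVlt ltnS => /predU1P[->//|/IH[h1 h2]].
  by have [_ _ /(_ i) h3 /(_ i) h4 _] := stS l; split; [exact: le_trans h3|exact: le_trans h2].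
pose c i := sup [set (st k).1 i | k in [set: nat]].
have cb i k l : (st l).1 i <= (st k).1 i + (st k).2.
  have [kl|/ltnW lk] := leqP k l.
    have [_ H] := mono i _ _ kl; apply: le_trans H.
    by rewrite lerDl ltW//; exact: (stP l).2.
  have [H _] := mono i _ _ lk; apply: le_trans H _.
  by rewrite lerDl ltW//; exact: (stP k).2.
have cE k i : (st k).1 i <= c i <= (st k).1 i + (st k).2.
  apply/andP; split.
    apply: sup_ubound; last by exists k.
    by exists ((st 0%N).1 i + (st 0%N).2) => _ [l _ <-].
  apply: ge_sup; first by exists ((st 0%N).1 i), 0%N.
  by move=> _ [l _ <-].
have bc : bounded_seq c.
  have [B cB] := bc0; exists (B + kappa0) => i.
  have := cB i; have /= := cE 0%N i; rewrite !ler_norml => /andP[? ?] /andP[? ?].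
  by apply/andP; split; lra.
exists c; split => //; first exact: (cE 0%N).
move=> k; have [b1 p1 _ _ [s [s0 H1 H2]]] := stS k.
exists s => //; apply: (@le_trans _ _ (eta k / 2 * s + 2 * (st k.+1).2)); last by lra.
move: H1; rewrite /second_difference.
set c' := (step _).1; set ka := (step _).2.
have cc' i : c' i <= c i <= c' i + ka := cE k.+1 i.
have l1 : h (fun i => c i + s * g k i) <= h (fun i => c' i + s * g k i) + ka.
  by apply: h_lip; try exact: bounded_seqD; move=> i; have := cc' i; lra.
have bN (d : int -> R) : bounded_seq d -> bounded_seq (fun i => d i - s * g k i).
  by move=> bd; have := bounded_seqD (- s) bd (g01 k); under eq_fun do rewrite mulNr.
have l2 : h (fun i => c i - s * g k i) <= h (fun i => c' i - s * g k i) + ka.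
  by apply: h_lip; try exact: bN; move=> i; have := cc' i; lra.
have l3 : h c' <= h c + 0.
  by apply: h_lip => // i; have := cc' i; lra.
rewrite -/ka; lra.
Qed.

End GenericPerturbation.

(** * Measures of cylinders as subgradients of the growth rate *)

Section Subgradient.
Variable R : realType.
Implicit Types (a : bool -> int -> R) (mu : probability full_shift R).

Definition occurrence a s (i : int) : R := \1_(cyl s) (translate i (best a)).

Lemma occurrence01 a s i : 0 <= occurrence a s i <= 1.
Proof. by rewrite /occurrence indicE; case: (_ \in _); rewrite ?ler01 ?lexx. Qed.

Lemma window01 (f : int -> R) i n : (forall j, 0 <= f j <= 1) ->
  0 <= window f i n <= n%:R.
Proof.
move=> f01; apply/andP; split; first by apply: sumr_ge0 => k _; case/andP: (f01 (i + k%:Z)).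
rewrite -[n in n%:R]card_ord -sumr_const; apply: ler_sum => k _.
by case/andP: (f01 (i + k%:Z)).
Qed.

Lemma window_shift_le (f : int -> R) (p : int) n : (forall j, 0 <= f j <= 1) ->
  window f p n <= window f 0 n + `|p|%N%:R.
Proof.
move=> f01; case: p => j.
  have := window_add f 0 j n; have := window_add f 0 n j; rewrite addnC !add0r => -> E.
  have /andP[? _] := window01 0 j f01; have /andP[_ ?] := window01 n%:Z j f01.
  by rewrite /=; lra.
have := window_add f (Negz j) j.+1 n; have := window_add f (Negz j) n j.+1.
rewrite addnC NegzE addNr => -> E.
have /andP[? _] := window01 (- j.+1%:Z + n%:Z) j.+1 f01.
have /andP[_ ?] := window01 (- j.+1%:Z) j.+1 f01.
by rewrite /=; lra.
Qed.

(** Bounds the boundary terms that arise when a window is moved by each site of [s] in turn. *)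
Definition code_radius (s : seq (int * bool)) : R := \sum_(p <- s) `|p.1|%N%:R.

Section Mismatches.
Variables (a : bool -> int -> R) (x : full_shift) (i : int) (n : nat).

(* The letter of [x] read at site [i + j] is [x (j + 1)], since words start at
   the coordinate 1. *)
Definition mismatch (j : int) : R := (x (j + 1) != best a (i + j))%:R.

Lemma mismatch01 j : 0 <= mismatch j <= 1.
Proof. by rewrite /mismatch; case: (_ != _); rewrite ?lexx ?ler01. Qed.

(** If [x] agrees with [best a] at every site that [s] reads, the two indicators coincide; otherwise
    some mismatch already contributes 1. *)
Lemma occurrence_mismatch s k :
  `|\1_(cyl s) (translate (k + 1) x) - occurrence a s (i + k)| <=
  \sum_(p <- s) mismatch (k + p.1).
Proof.
have mem_cyl y : (y \in cyl s) = all (fun p => y p.1 == p.2) s.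
  by apply/idP/idP; rewrite inE.
rewrite /occurrence !indicE !mem_cyl.
have [/allP H|] := boolP (all (fun p => x (k + p.1 + 1) == best a (i + (k + p.1))) s).
  rewrite (_ : all _ s = all (fun p => translate (i + k) (best a) p.1 == p.2) s).
    by rewrite subrr normr0 sumr_ge0// => p _; case/andP: (mismatch01 (k + p.1)).
  apply: eq_in_all => p ps; rewrite /translate; move/H : ps => /eqP.
  by rewrite [p.1 + (k + 1)]addrA [p.1 + k]addrC => ->; rewrite [p.1 + _]addrC addrA.
rewrite -has_predC => /hasP[p ps /= np]; rewrite (big_rem p)//=.
apply: (@le_trans _ _ 1).
  by case: (all _ _); case: (all _ _); rewrite ?subrr ?subr0 ?sub0r ?normrN ?normr1 ?normr0 ?ler01.
by rewrite {1}/mismatch np lerDl sumr_ge0.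
Qed.

(** Each entry of [s] counts the mismatches in a displaced window; moving that window back to the
    origin costs the absolute value of its site. *)
Lemma window_occurrence s :
  `|\sum_(k < n) \1_(cyl s) (translate (k%:Z + 1) x) - window (occurrence a s) i n| <=
  (size s)%:R * window mismatch 0 n + code_radius s.
Proof.
rewrite /window -sumrB; apply: le_trans (ler_norm_sum _ _ _) _.
apply: (@le_trans _ _ (\sum_(k < n) \sum_(p <- s) mismatch (k%:Z + p.1))).
  by apply: ler_sum => k _; exact: occurrence_mismatch.
rewrite exchange_big/= /code_radius.
have -> : (size s)%:R * window mismatch 0 n = \sum_(p <- s) window mismatch 0 n.
  by rewrite big_const_seq count_predT iter_addr_0 mulr_natl.
rewrite -big_split/=; apply: ler_sum => p _.
by under eq_bigr do rewrite addrC; apply: window_shift_le => j; exact: mismatch01.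
Qed.

End Mismatches.

Definition gap a (eps : R) :=
  forall b i, a b i + eps * (b != best a i)%:R <= peak a i.

Lemma mismatch_le_gap a eps x i n : 0 < eps -> gap a eps ->
  weight_sum a (prefix_word x n) i + eps * window (mismatch a x i) 0 n <=
  window (peak a) i n.
Proof.
move=> e0 ga; rewrite /weight_sum size_prefix_word /window mulr_sumr -big_split/=.
apply: ler_sum => k _; rewrite /mismatch add0r /prefix_word.
rewrite (nth_map 0%N) ?size_iota// nth_iota// -PoszD addn1 add1n.
exact: ga.
Qed.

(** Counting visits of [x] to the cylinder instead of occurrences along [best a] costs about
    [|t| * size s] per mismatch, while by [gap] each mismatch lowers the weight sum by [eps]. So the
    error is at most [K] times the deficit of the weight sum, and putting [K] copies of both
    quantities on the two sides absorbs it. *)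
Lemma subgradient_pointwise a eps s (t K : R) n x :
  bounded_weights a -> 0 < eps -> gap a eps -> K = `|t| * (size s)%:R / eps ->
  (1 + K) * weight_sup a (prefix_word x n) +
    t * \sum_(k < n) \1_(cyl s) (translate (k%:Z + 1) x) <=
  window_sup (fun i => peak a i + t * occurrence a s i) n +
    K * window_sup (peak a) n + `|t| * code_radius s.
Proof.
move=> ba e0 ga KE.
have K0 : 0 <= K by rewrite KE divr_ge0 ?mulr_ge0// ltW.
have bp := bounded_peak ba.
have bq : bounded_seq (fun i => peak a i + t * occurrence a s i).
  by apply: bounded_seqD => // i; exact: occurrence01.
rewrite -lerBrDr -ler_pdivlMl; last lra.
apply: weight_sup_le => i; rewrite ler_pdivlMl; last lra.
rewrite lerBrDr.
have h1 := window_sup_ub i n bp; have h2 := window_sup_ub i n bq.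
have h3 := mismatch_le_gap x i n e0 ga.
have h4 := window_occurrence a x i n s.
have M0 : 0 <= window (mismatch a x i) 0 n.
  by have /andP[] := window01 0 n (mismatch01 a x i).
move: h2 h3 h4 M0; set S := weight_sum _ _ _; set M := window (mismatch _ _ _) _ _.
set N := \sum_(_ < _) _.
have -> : window (fun j => peak a j + t * occurrence a s j) i n =
    window (peak a) i n + t * window (occurrence a s) i n.
  by rewrite /window big_split/= mulr_sumr.
set W := window (occurrence _ _) _ _ => h2 h3 h4 M0.
have h5 : t * N <= t * W + `|t| * ((size s)%:R * M + code_radius s).
  rewrite -lerBlDl -mulrBr; apply: le_trans (ler_norm _) _.
  by rewrite normrM ler_wpM2l.
have h6 : `|t| * ((size s)%:R * M) <= K * (window_sup (peak a) n - S).
  have -> : K * (window_sup (peak a) n - S) =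
      `|t| * ((size s)%:R * ((window_sup (peak a) n - S) / eps)) by rewrite KE; ring.
  by rewrite !ler_wpM2l// ler_pdivlMr//; lra.
have h7 : 0 <= eps * M by rewrite mulr_ge0// ltW.
rewrite mulrDr in h5; rewrite mulrBr in h6; rewrite mulrDl mul1r; lra.
Qed.


(** Integrate [subgradient_pointwise] and divide by [n]. Invariance turns the count of visits into
    [n * mu C], and optimality makes the [K] copies on both sides have the same limit, so that they
    cancel. *)
Lemma growth_subgradient a eps s (t : R) mu : bounded_weights a -> 0 < eps -> gap a eps ->
  optimal a mu ->
  growth (peak a) + t * fine (mu (cyl s)) <=
  growth (fun i => peak a i + t * occurrence a s i).
Proof.
move=> ba e0 ga [imu omu].
set K := `|t| * (size s)%:R / eps.
have K0 : 0 <= K by rewrite /K divr_ge0 ?mulr_ge0// ltW.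
have bp := bounded_peak ba.
have bq : bounded_seq (fun i => peak a i + t * occurrence a s i).
  by apply: bounded_seqD => // i; exact: occurrence01.
set g := growth (peak a); set q := fun i => _ : R; set m := fine _.
have H n : (1 + K) * (n%:R * g) + t * (n%:R * m) <=
    window_sup q n + K * window_sup (peak a) n + `|t| * code_radius s.
  pose A k := translate (k%:Z + 1) @^-1` cyl s.
  have mA k : measurable (A k) by rewrite /A translate_cyl; exact: measurable_cyl.
  have iN : mu.-integrable setT (EFin \o (fun x => \sum_(k < n) t * \1_(A k) x)).
    by apply: integrable_indic_sum => k; exact: mA.
  have iF : mu.-integrable setT (EFin \o (fun x => (1 + K) * weight_sup a (prefix_word x n))).
    rewrite (_ : _ \o _ = (fun x => (1 + K)%:E * (EFin \o
        (fun x => weight_sup a (prefix_word x n))) x)%E); last first.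
      by apply/funext => x /=; rewrite EFinM.
    by apply: integrableZl => //; exact: integrable_weight_sup.
  rewrite -[leRHS](integral_cst_probability mu).
  apply: (@le_trans _ _ (\int[mu]_x ((1 + K) * weight_sup a (prefix_word x n) +
      \sum_(k < n) t * \1_(A k) x))); last first.
    apply: le_Rintegral => //.
    - exact: integrable_EFinD.
    - exact: finite_measure_integrable_cst.
    - move=> x _; rewrite -mulr_sumr.
      have -> : \sum_(k < n) \1_(A k) x = \sum_(k < n) \1_(cyl s) (translate (k%:Z + 1) x) :> R.
        apply: eq_bigr => k _; rewrite !indicE.
        have [h|h] := pselect (cyl s (translate (k%:Z + 1) x)).
          by rewrite !mem_set.
        by rewrite !memNset.
      exact: (@subgradient_pointwise a eps).
  rewrite RintegralD// RintegralZl//; last exact: integrable_weight_sup.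
  rewrite Rintegral_indic_sum; last by move=> k; exact: mA.
  apply: lerD; first by rewrite ler_wpM2l// addr_ge0.
  rewrite (eq_bigr (fun=> t * m)) => [|k _].
    by rewrite sumr_const card_ord -[leRHS]mulr_natl [leRHS]mulrCA.
  rewrite /A /m (_ : k%:Z + 1 = k.+1%:Z); last by rewrite intS addrC.
  by rewrite shift_invariant_translate//; exact: measurable_cyl.
suff : (1 + K) * g + t * m <= growth q + K * g + 0 by lra.
have cv : (fun n => n%:R^-1 * window_sup q n + K * (n%:R^-1 * window_sup (peak a) n) +
    `|t| * code_radius s * n%:R^-1) @ \oo --> growth q + K * g + `|t| * code_radius s * 0.
  apply: cvgD; last first.
    by apply: cvgMr; rewrite -cvg_shiftS; exact: cvg_harmonic.
  by apply: cvgD; [exact: growth_cvg|apply: cvgMr; exact: growth_cvg].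
rewrite mulr0 in cv; apply: (cvgr_to_ge cv); near=> n.
have n0 : 0 < n%:R :> R by rewrite ltr0n; near: n; exists 1%N.
have n1 : n%:R != 0 :> R by rewrite gt_eqF.
rewrite -(ler_pM2l n0); apply: le_trans (le_trans (H n) _).
  by rewrite mulrDr !(mulrCA n%:R).
rewrite le_eqVlt; apply/orP; left; apply/eqP.
set u := window_sup q n; set v := window_sup _ n; set w := `|t| * _.
by rewrite -[LHS]/(u + K * v + w); field.
Unshelve. all: by end_near. Qed.

Lemma exists_unique_optimal a (eps : R) : bounded_weights a -> 0 < eps ->
  exists a', [/\ bounded_weights a', forall b i, a b i <= a' b i <= a b i + eps &
    forall mu nu, optimal a' mu -> optimal a' nu -> forall s, mu (cyl s) = nu (cyl s)].
Proof.
move=> ba eps0; have bp := bounded_peak ba.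
(* One half of [eps] creates the gap, the other half is left for the generic perturbation. *)
pose d := eps / 2; have d0 : 0 < d by rewrite divr_gt0.
have dE : d + d = eps by rewrite /d -splitr.
have bc0 : bounded_seq (fun i => peak a i + d).
  by have [B pB] := bp; exists (B + d) => i; rewrite (le_trans (ler_normD _ _))// lerD// gtr0_norm.
(* A direction is a cylinder together with a tolerance [1 / (j + 1)]; numbers that encode no pair
   repeat the pair [([::], 0)]. *)
pose idx k : seq (int * bool) * nat := odflt ([::], 0%N) (unpickle k).
pose g k i := occurrence a (idx k).1 i.
pose eta k : R := (idx k).2.+1%:R^-1.
have g01 k i : 0 <= g k i <= 1 by exact: occurrence01.
have eta0 k : 0 < eta k by rewrite invr_gt0.
have [c [bc cc0 Hc]] := generic_perturbation (@growth_lip R) g01 eta0 bc0 d0.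
(* The preferred letter is raised by [d]; then both letters are raised equally, which preserves
   [best] and the gap and turns the peak into [c]. *)
pose a' b i := a b i + d * (b == best a i)%:R + (c i - (peak a i + d)).
have bestE : best a' = best a.
  apply/funext => i; rewrite {1}/best /a' lerD2r.
  case E : (best a i); rewrite /= mulr0 mulr1 addr0.
    by apply: le_trans (_ : a true i <= _); [exact: E|rewrite lerDl ltW].
  apply/negbTE; rewrite -ltNge; move/negbT : E; rewrite /best -ltNge => E.
  by apply: lt_trans E _; rewrite ltrDl.
have peakE : peak a' = c.
  by apply/funext => i; rewrite /peak bestE /a' eqxx mulr1 /peak; ring.
have a'a b i : a b i <= a' b i <= a b i + eps.
  have /andP[c1 c2] := cc0 i; rewrite /a'.
  have : 0 <= d * (b == best a i)%:R <= d.
    by case: (b == _); rewrite ?mulr1 ?mulr0 ?lexx (ltW d0).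
  by move=> /andP[? ?]; apply/andP; split; lra.
have ba' : bounded_weights a'.
  have [B aB] := ba; exists (B + eps) => b i.
  have := aB b i; have := a'a b i; rewrite !ler_norml => /andP[? ?] /andP[? ?].
  by apply/andP; split; lra.
have ga' : gap a' d.
  move=> b i; rewrite peakE bestE /a'; have := le_peak a b i.
  by case: (b == _) => /=; rewrite ?mulr1 ?mulr0; lra.
exists a'; split => // mu nu omu onu s.
have le_nu (mu1 nu1 : probability full_shift R) : optimal a' mu1 -> optimal a' nu1 ->
    fine (mu1 (cyl s)) <= fine (nu1 (cyl s)).
  move=> om on; apply/ler_addgt0Pr => e e0.
  pose j := Num.bound e^-1.
  have je : j.+1%:R^-1 <= e.
    rewrite -[leRHS]invrK lef_pV2 ?posrE ?invr_gt0//.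
    have ej : e^-1 < j%:R by apply: archi_boundP; rewrite invr_ge0 ltW.
    by apply: le_trans (ltW ej) _; rewrite ler_nat.
  have [r r0] := Hc (pickle (s, j)).
  rewrite /second_difference /g /eta /idx pickleK/= => H.
  (* One measure is tested in the direction [r], the other in the direction [- r]; the sum of the
     two inequalities bounds [r] times the difference of the measures by the second difference,
     which is at most [r / (j + 1)]. *)
  have := growth_subgradient s r ba' d0 ga' om.
  have := growth_subgradient s (- r) ba' d0 ga' on.
  rewrite peakE /occurrence bestE.
  rewrite (_ : (fun i => c i + - r * _) =
      (fun i => c i - r * \1_(cyl s) (translate i (best a)))); last first.
    by apply/funext => i; rewrite mulNr.
  rewrite /occurrence in H => h1 h2.
  rewrite -(ler_pM2l r0) mulrDr; apply: (@le_trans _ _ (r * fine (nu1 (cyl s)) + j.+1%:R^-1 * r)).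
    have slopes (x y z u v w : R) : x + y - 2 * z <= w -> z - v <= y -> z + u <= x ->
      u <= v + w by lra.
    by apply: slopes H _ h2; rewrite -mulNr; exact: h1.
  by rewrite lerD2l mulrC ler_pM2l.
have fn (la : probability full_shift R) : la (cyl s) \is a fin_num.
  by apply: fin_num_measure; exact: measurable_cyl.
suff E : fine (mu (cyl s)) = fine (nu (cyl s)).
  by rewrite -(fineK (fn mu)) E (fineK (fn nu)).
by apply/le_anti; rewrite !le_nu.
Qed.

End Subgradient.

(** * Operators that act on an orthonormal basis by shifts and scalars *)

Section Hilbert.
Variables (R : realType) (H : completeNormedModType R).
Variables (dot : {dot H for idfun}) (dot_norm : forall x : H, dot x x = `|x| ^+ 2).
Variables (e : int -> H) (e_basis : orthonormal_basis dot e).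

Lemma dotE i j : dot (e i) (e j) = (i == j)%:R. Proof. exact: e_basis.1. Qed.

Lemma dot_suml (I : Type) (s : seq I) (F : I -> H) y :
  dot (\sum_(i <- s) F i) y = \sum_(i <- s) dot (F i) y.
Proof. exact: linear_sumlz. Qed.

Lemma dot_sumr (I : Type) (s : seq I) (F : I -> H) y :
  dot y (\sum_(i <- s) F i) = \sum_(i <- s) dot y (F i).
Proof. exact: linear_sumr. Qed.

Lemma dotZl c x y : dot (c *: x) y = c * dot x y.
Proof. exact: linearZl_LR. Qed.

Lemma dotZr c x y : dot x (c *: y) = c * dot x y.
Proof. by rewrite linearZr_LR. Qed.

Lemma dotBl x y z : dot (x - y) z = dot x z - dot y z.
Proof. exact: linearBl. Qed.

Lemma dotBr x y z : dot z (x - y) = dot z x - dot z y.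
Proof. exact: linearBr. Qed.

Lemma dotC x y : dot x y = dot y x.
Proof. by rewrite hermC expr0 mul1r. Qed.

Definition orthonormal_family (I : eqType) (u : I -> H) :=
  forall i j, dot (u i) (u j) = (i == j)%:R.

Lemma dot_sum_orthonormal (I : eqType) (u : I -> H) (s : seq I) (c : I -> R) i :
  orthonormal_family u -> uniq s -> i \in s ->
  dot (u i) (\sum_(j <- s) c j *: u j) = c i.
Proof.
move=> ou us si; rewrite dot_sumr (bigD1_seq i)//= dotZr ou eqxx mulr1.
rewrite big1 ?addr0// => j ji.
by rewrite dotZr ou eq_sym (negPf ji) mulr0.
Qed.

Lemma pythagoras (I : eqType) (u : I -> H) (s : seq I) (c : I -> R) :
  orthonormal_family u -> uniq s ->
  `|\sum_(i <- s) c i *: u i| ^+ 2 = \sum_(i <- s) c i ^+ 2.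
Proof.
move=> ou us; rewrite -dot_norm dot_suml [LHS]big_seq [RHS]big_seq; apply: eq_bigr => i si.
by rewrite dotZl dot_sum_orthonormal// expr2.
Qed.

Lemma bessel (I : eqType) (u : I -> H) (s : seq I) x :
  orthonormal_family u -> uniq s -> \sum_(i <- s) dot x (u i) ^+ 2 <= `|x| ^+ 2.
Proof.
move=> ou us; set y := \sum_(i <- s) dot x (u i) *: u i.
have xy : dot x y = \sum_(i <- s) dot x (u i) ^+ 2.
  by rewrite dot_sumr; apply: eq_bigr => i _; rewrite dotZr expr2.
have := sqr_ge0 `|x - y|; rewrite -dot_norm dotBl !dotBr (dotC y x) [dot y y]dot_norm.
by rewrite pythagoras// xy dot_norm; lra.
Qed.

Lemma norm_e i : `|e i| = 1.
Proof.
have /eqP : `|e i| ^+ 2 = 1 by rewrite -dot_norm dotE eqxx.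
by rewrite sqrp_eq1// => /eqP.
Qed.

Lemma orthonormal_e n : orthonormal_family (fun i => e (i + n)).
Proof. by move=> i j; rewrite dotE (inj_eq (addIr _)). Qed.

Implicit Types T L : bounded_op H.

Lemma bopD T x y : T (x + y) = T x + T y.
Proof. by have [lT _] := bounded_opP T; have := lT 1 x y; rewrite !scale1r. Qed.

Lemma bop0 T : T 0 = 0.
Proof. by have := bopD T 0 0; rewrite addr0 => /eqP; rewrite -{1}[T 0]addr0 (inj_eq (addrI _)) => /eqP. Qed.

Lemma bopZ T c x : T (c *: x) = c *: T x.
Proof. by have [lT _] := bounded_opP T; have := lT c x 0; rewrite !addr0 bop0 addr0. Qed.

Lemma bop_sum T (I : Type) (s : seq I) (F : I -> H) :
  T (\sum_(i <- s) F i) = \sum_(i <- s) T (F i).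
Proof. by elim: s => [|i s IH]; rewrite ?big_nil ?bop0// !big_cons bopD IH. Qed.

Lemma opnorm_le T x : `|T x| <= `|T| * `|x|.
Proof.
have [->|x0] := eqVneq x 0; first by rewrite bop0 !normr0 mulr0.
have xN : 0 < `|x| by rewrite normr_gt0.
rewrite -ler_pdivrMr// mulrC -[`|x|^-1]gtr0_norm ?invr_gt0// -normrZ -bopZ.
by apply: opnorm_ub; rewrite normrZ normfV normr_id mulVf// gt_eqF.
Qed.

(** The span in [orthonormal_basis] allows repeated indices; merging them makes [pythagoras]
    applicable. *)
Lemma span_uniq (s : seq int) (c : int -> R) : exists2 s', uniq s' &
  exists c', \sum_(i <- s) c i *: e i = \sum_(i <- s') c' i *: e i.
Proof.
exists (undup s); first exact: undup_uniq.
exists (fun i => (count_mem i s)%:R * c i).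
rewrite -big_undup_iterop_count; apply: eq_bigr => i _.
by rewrite Monoid.iteropE iter_addr_0 -scalerA scaler_nat.
Qed.

(** On finite combinations this is Pythagoras, since the images of the basis vectors are still
    orthogonal; boundedness of [T] extends it to the closure. *)
Lemma shift_norm_le T n (beta : int -> R) (M : R) :
  (forall i, T (e i) = beta i *: e (i + n)) -> (forall i, `|beta i| <= M) ->
  forall x, `|T x| <= M * `|x|.
Proof.
move=> Tb bM x; have M0 : 0 <= M by apply: le_trans (bM 0).
have spanM s c : `|T (\sum_(i <- s) c i *: e i)| <= M * `|\sum_(i <- s) c i *: e i|.
  have [s' us [c' ->]] := span_uniq s c.
  rewrite -(@ler_pXn2r _ 2)// ?nnegrE ?mulr_ge0// exprMn bop_sum.
  under eq_bigr do rewrite bopZ Tb scalerA.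
  rewrite (pythagoras _ (orthonormal_e n))//.
  have oe : orthonormal_family e by exact: dotE.
  rewrite (pythagoras _ oe)// mulr_sumr; apply: ler_sum => i _.
  rewrite exprMn mulrC ler_wpM2r ?sqr_ge0// -[leLHS]real_normK ?num_real//.
  by rewrite ler_pXn2r ?nnegrE.
apply/ler_addgt0Pr => d d0.
(* Approximating [x] within [r] costs at most [(|T| + M) * r]; adding 1 keeps the denominator
   positive. *)
pose r := d / (`|T| + M + 1).
have K0 : 0 < `|T| + M + 1 by rewrite ltr_wpDl// addr_ge0.
have r0 : 0 < r by rewrite divr_gt0.
have : closure [set x | exists (s : seq int) (c : int -> R), x = \sum_(i <- s) c i *: e i] x.
  by rewrite e_basis.2.
move=> /(_ (ball x r) (nbhsx_ballx _ _ r0)) [_ [[s [c ->]]]].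
set y := \sum_(i <- s) _; rewrite -ball_normE/= => xy.
have -> : T x = T (x - y) + T y by rewrite -bopD subrK.
apply: le_trans (ler_normD _ _) _.
have h1 := opnorm_le T (x - y); have h2 : `|T y| <= M * `|y| := spanM s c.
have h3 : `|y| <= `|x| + `|x - y|.
  by rewrite -[y in leLHS](subKr x) (le_trans (ler_normB _ _)).
have h4 : r * (`|T| + M + 1) = d by rewrite /r divfK// gt_eqF.
have h5 : `|T| * `|x - y| <= `|T| * r by rewrite ler_wpM2l// ltW.
have h6 : M * `|y| <= M * (`|x| + r).
  by rewrite ler_wpM2l// (le_trans h3)// lerD2l ltW.
rewrite mulrDr in h6; lra.
Qed.

Lemma opnorm_shift_le T n (beta : int -> R) (M : R) :
  (forall i, T (e i) = beta i *: e (i + n)) -> (forall i, `|beta i| <= M) -> `|T| <= M.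
Proof.
move=> Tb bM; apply: opnorm_lub => x x1.
have M0 : 0 <= M by apply: le_trans (bM 0).
by apply: le_trans (shift_norm_le Tb bM x) _; rewrite ler_piMr.
Qed.

Lemma opnorm_shift_ge T n (beta : int -> R) i :
  (forall i, T (e i) = beta i *: e (i + n)) -> `|beta i| <= `|T|.
Proof.
move=> Tb; have := opnorm_le T (e i).
by rewrite Tb normrZ !norm_e !mulr1.
Qed.

Lemma bop_eq T T' : (forall i, T (e i) = T' (e i)) -> T = T'.
Proof.
move=> TT'; apply/eqP; rewrite -subr_eq0 -normr_le0.
apply: (@opnorm_shift_le _ 0 (fun=> 0)) => [i|i]; last by rewrite normr0.
have -> : (T - T') (e i) = T (e i) - T' (e i) by [].
by rewrite TT' subrr scale0r.
Qed.

Section Diagonal.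
Variables (d : int -> R) (M : R).
Hypothesis dM : forall i, `|d i| <= M.

Let u k := e (znth k).

Let ou : orthonormal_family u.
Proof. by move=> i j; rewrite dotE (inj_eq (can_inj znthK)). Qed.

Let M0 : 0 <= M. Proof. exact: le_trans (dM 0). Qed.

Let partial x n := \sum_(0 <= k < n) (d (znth k) * dot x (u k)) *: u k.

Let partial_norm x n m :
  `|\sum_(n <= k < m) (d (znth k) * dot x (u k)) *: u k| ^+ 2 <=
  M ^+ 2 * \sum_(n <= k < m) dot x (u k) ^+ 2.
Proof.
rewrite (pythagoras _ ou) ?iota_uniq// mulr_sumr; apply: ler_sum => k _.
rewrite exprMn ler_wpM2r ?sqr_ge0// -[leLHS]real_normK ?num_real//.
by rewrite ler_pXn2r ?nnegrE.
Qed.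

(** Bessel makes the squared coefficients summable, Pythagoras transfers the Cauchy property to the
    vectors, and [H] is complete. *)
Let partial_cvg x : cvg (partial x n @[n --> \oo]).
Proof.
apply/cauchy_cvgP/cauchy_seriesP => eps eps0.
have : cvg (series (fun k => dot x (u k) ^+ 2) @ \oo).
  apply: nondecreasing_is_cvgn.
    by apply: nondecreasing_series => k _ _; rewrite sqr_ge0.
  exists (`|x| ^+ 2) => _ [n _ <-].
  by apply: bessel ou _; exact: iota_uniq.
move=> /cauchy_cvgP/cauchy_seriesP.
have r0 : 0 < (eps / (M + 1)) ^+ 2 by rewrite exprn_gt0// divr_gt0// ltr_wpDl.
move=> /(_ _ r0); apply: filterS => -[n m] /=.
rewrite ger0_norm ?sumr_ge0// => [S|k _]; last by rewrite sqr_ge0.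
rewrite -(@ltr_pXn2r _ 2)// ?nnegrE ?(ltW eps0)//; apply: le_lt_trans (partial_norm x n m) _.
have M1 : 0 < M + 1 by rewrite ltr_wpDl.
apply: (@le_lt_trans _ _ ((M + 1) ^+ 2 * \sum_(n <= k < m) dot x (u k) ^+ 2)).
  rewrite ler_wpM2r ?sumr_ge0// => [k _|]; first exact: sqr_ge0.
  by rewrite ler_pXn2r ?nnegrE ?(ltW M1)// lerDl.
by rewrite -ltr_pdivlMl ?exprn_gt0// -exprVn -exprMn mulrC.
Qed.

Let diag x : H := lim (partial x n @[n --> \oo]).

Let diag_subproof : diag \in @bounded_linear R H.
Proof.
rewrite unfold_in; apply/asboolP; split.
  move=> c x y; rewrite /diag.
  rewrite (_ : partial (c *: x + y) = fun n => c *: partial x n + partial y n); last first.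
    apply/funext => n; rewrite /partial scaler_sumr -big_split/=; apply: eq_bigr => k _.
    by rewrite linearDl/= dotZl scalerA -scalerDl; congr (_ *: _); ring.
  by apply: cvg_lim => //; apply: cvgD; [apply: cvgZr|]; exact: partial_cvg.
exists M => x; rewrite -lim_norm; last exact: partial_cvg.
apply: limr_le; first by apply: is_cvg_norm; exact: partial_cvg.
near=> n; rewrite -(@ler_pXn2r _ 2)// ?nnegrE ?mulr_ge0// exprMn.
apply: le_trans (partial_norm x 0 n) _; rewrite ler_wpM2l ?sqr_ge0//.
by apply: bessel ou _; exact: iota_uniq.
Unshelve. all: by end_near. Qed.

(** Composition with a diagonal operator is how the weights of a shift are altered later. *)
Lemma diagonal_op_exists : exists D : bounded_op H, forall i, D (e i) = d i *: e i.
Proof.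
exists (BoundedOp diag_subproof) => i /=; rewrite /diag.
apply: cvg_lim => //; apply: cvg_near_cst.
exists (zindex i).+1 => // n /= ni; rewrite /partial.
rewrite (bigD1_seq (zindex i)) ?iota_uniq ?mem_index_iota//= /u zindexK.
rewrite dotE eqxx mulr1 big1 ?addr0// => k ki.
rewrite dotE; case: eqVneq => [ik|]; last by rewrite mulr0 scale0r.
by rewrite ik znthK eqxx in ki.
Qed.

End Diagonal.

End Hilbert.

(** * Weighted shifts: norms of products, perturbation and continuity of the weights *)

Section ShiftPairs.
Variables (R : realType) (H : completeNormedModType R).
Variables (dot : {dot H for idfun}) (dot_norm : forall x : H, dot x x = `|x| ^+ 2).
Variables (e : int -> H) (e_basis : orthonormal_basis dot e).
Implicit Types (T : bounded_op H) (L : bounded_op H * bounded_op H) (a : bool -> int -> R).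

Definition letter_op L (b : bool) : bounded_op H := if b then L.2 else L.1.

Definition has_log_weights L a :=
  forall b i, letter_op L b (e i) = expR (a b i) *: e (i + 1).

(** Weights are positive and basis vectors have norm 1, so the norm of an image recovers the
    weight. *)
Definition log_weights L (b : bool) (i : int) : R := ln `|letter_op L b (e i)|.

(** The inverse has the reciprocal weights, so the norms of the operator and of its inverse bound
    the weights from above and away from zero. *)
Lemma positive_shiftE T : positive_invertible_shift e T ->
  (forall i, T (e i) = expR (ln `|T (e i)|) *: e (i + 1)) /\
  exists B, forall i, `|ln `|T (e i)| | <= B.
Proof.
move=> [[S [TS ST]] [alpha a0 Ta]].
have nT i : `|T (e i)| = alpha i.
  by rewrite Ta normrZ (norm_e dot_norm e_basis) mulr1 gtr0_norm.
split; first by move=> i; rewrite nT lnK// posrE.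
exists (`|ln `|T| | + `|ln `|S| |) => i; rewrite nT.
have aT j : alpha j <= `|T|.
  by rewrite -nT (le_trans (opnorm_le _ _))// (norm_e dot_norm e_basis) mulr1.
have aS j : (alpha j)^-1 <= `|S|.
  have SE : S (e (j + 1)) = (alpha j)^-1 *: e j.
    have : op_comp S T (e j) = e j by rewrite ST.
    by rewrite /= Ta bopZ => <-; rewrite scalerA mulVf ?scale1r// gt_eqF.
  have := opnorm_le S (e (j + 1)).
  rewrite SE normrZ !(norm_e dot_norm e_basis) !mulr1.
  by rewrite gtr0_norm ?invr_gt0.
have T0 : 0 < `|T| by apply: lt_le_trans (aT 0).
have S0 : 0 < `|S| by apply: lt_le_trans (aS 0); rewrite invr_gt0.
have h1 j : ln (alpha j) <= ln `|T| by rewrite ler_ln ?posrE.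
have h2 j : - ln `|S| <= ln (alpha j).
  by rewrite lerNl -lnV ?posrE// ler_ln ?posrE ?invr_gt0.
rewrite ler_norml; have := h1 i; have := h2 i.
have := ler_norm (ln `|T|); have := ler_norm (ln `|S|).
have := normr_ge0 (ln `|T|); have := normr_ge0 (ln `|S|).
by move=> *; apply/andP; split; lra.
Qed.

Lemma has_log_weightsP L : shift_pairs e L ->
  has_log_weights L (log_weights L) /\ bounded_weights (log_weights L).
Proof.
move=> [/positive_shiftE[E1 [B1 H1]] /positive_shiftE[E2 [B2 H2]]]; split.
  by case=> i; [exact: E2|exact: E1].
exists (Num.max B1 B2) => -[] i; rewrite le_max.
  by rewrite H2 orbT.
by rewrite H1.
Qed.

Lemma log_weightsE L a : has_log_weights L a -> log_weights L = a.
Proof.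
move=> La; apply/funext => b; apply/funext => i.
by rewrite /log_weights La normrZ (norm_e dot_norm e_basis) mulr1 gtr0_norm ?expR_gt0// expRK.
Qed.

Section Weights.
Variables (L : bounded_op H * bounded_op H) (a : bool -> int -> R).
Hypotheses (La : has_log_weights L a) (ba : bounded_weights a).

Lemma word_op_shift w i :
  word_op L w (e i) = expR (weight_sum a w i) *: e (i + (size w)%:Z).
Proof.
elim/last_ind: w => [|w b IH].
  by rewrite /weight_sum big_ord0 expR0 scale1r addr0.
rewrite /word_op foldl_rcons -/(word_op L w) /= IH bopZ La scalerA -expRD.
rewrite -cats1 weight_sum_cat [weight_sum a [:: b] _]big_ord1/= addr0.
by rewrite size_cat PoszD addrA.
Qed.

Lemma norm_word_op w : `|word_op L w| = expR (weight_sup a w).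
Proof.
have norm_expR (x : R) : `|expR x| = expR x by rewrite gtr0_norm ?expR_gt0.
apply/eqP; rewrite eq_le; apply/andP; split.
  apply: (opnorm_shift_le dot_norm e_basis (word_op_shift w)) => i.
  by rewrite norm_expR ler_expR weight_sup_ub.
have ge i : expR (weight_sum a w i) <= `|word_op L w|.
  rewrite -[leLHS]norm_expR.
  exact: (opnorm_shift_ge dot_norm e_basis i (word_op_shift w)).
have p : 0 < `|word_op L w| by apply: lt_le_trans (ge 0); rewrite expR_gt0.
rewrite -[leRHS]lnK ?posrE// ler_expR; apply: weight_sup_le => i.
by rewrite -ler_expR lnK ?posrE.
Qed.

Lemma ln_norm_word_op w : ln `|word_op L w| = weight_sup a w.
Proof. by rewrite norm_word_op expRK. Qed.

Lemma sup_word_op n : sup [set `|word_op L w| `^ n.+1%:R^-1 | w in [set: n.+1.-tuple bool]] =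
  expR (n.+1%:R^-1 * window_sup (peak a) n.+1).
Proof.
have powE w : `|word_op L w| `^ n.+1%:R^-1 = expR (n.+1%:R^-1 * weight_sup a w).
  by rewrite norm_word_op /powR gt_eqF ?expR_gt0// expRK.
set S := [set _ | _ in _].
have S0 : S !=set0 by exists (`|word_op L (nseq_tuple n.+1 false)| `^ n.+1%:R^-1), (nseq_tuple n.+1 false).
have bS : ubound S (expR (n.+1%:R^-1 * window_sup (peak a) n.+1)).
  move=> _ [w _ <-]; rewrite powE ler_expR ler_wpM2l ?invr_ge0//.
  by rewrite -[in leRHS](size_tuple w); exact: weight_sup_le_window.
apply/eqP; rewrite eq_le; apply/andP; split; first exact: ge_sup.
(* The word that follows [best a] along a window realises the sum of peaks over it. *)
have ge i : expR (n.+1%:R^-1 * window (peak a) i n.+1) <= sup S.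
  pose w := [seq best a (i + k%:Z) | k <- iota 0 n.+1].
  have sw : size w == n.+1 by rewrite size_map size_iota.
  apply: (@le_trans _ _ (`|word_op L (Tuple sw)| `^ n.+1%:R^-1)).
    rewrite powE ler_expR ler_wpM2l ?invr_ge0// -weight_sum_best.
    exact: weight_sup_ub.
  by apply: sup_ubound; [eexists; exact: bS|exists (Tuple sw)].
have p : 0 < sup S by apply: lt_le_trans (ge 0); rewrite expR_gt0.
rewrite -[leRHS]lnK ?posrE// ler_expR ler_pdivrMl//; apply: window_sup_le => i.
by rewrite -ler_pdivrMl// -ler_expR lnK ?posrE.
Qed.

Lemma joint_spectral_radiusE : joint_spectral_radius L = expR (growth (peak a)).
Proof.
apply: cvg_lim => //; rewrite -cvg_shiftS.
rewrite (_ : [sequence _]_n = (fun n => expR (n.+1%:R^-1 * window_sup (peak a) n.+1))); last first.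
  by apply/funext => n; rewrite -sup_word_op.
have h := growth_cvg (bounded_peak ba); rewrite -cvg_shiftS in h.
by apply: continuous_cvg; [exact: continuous_expR|exact: h].
Qed.

Lemma maximising_optimal mu : maximising_measure L mu <-> optimal a mu.
Proof.
rewrite optimalP// /maximising_measure joint_spectral_radiusE expRK.
rewrite (_ : (fun n => n%:R^-1 * \int[mu]_x ln _) =
  (fun n => n%:R^-1 * \int[mu]_x weight_sup a (prefix_word x n)))//.
apply/funext => n; congr (_ * _); apply: eq_Rintegral => x _.
exact: ln_norm_word_op.
Qed.

End Weights.

(** Compose [T] with the diagonal operator of entries [expR (a1 i - a0 i)], whose inverse is
    diagonal too. The difference is again a weighted shift, so its norm is read off its
    coefficients. *)
Lemma perturb_shift T (a0 a1 : int -> R) (eps : R) : 0 <= eps ->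
  positive_invertible_shift e T ->
  (forall i, T (e i) = expR (a0 i) *: e (i + 1)) -> (forall i, a0 i <= a1 i <= a0 i + eps) ->
  exists T', [/\ positive_invertible_shift e T',
    forall i, T' (e i) = expR (a1 i) *: e (i + 1) &
    `|T - T'| <= `|T| * (expR eps - 1)].
Proof.
move=> eps0 [[S [TS ST]] _] Ta a01.
have norm_expR (x : R) : `|expR x| = expR x by rewrite gtr0_norm ?expR_gt0.
have [D De] : exists D : bounded_op H, forall i, D (e i) = expR (a1 i - a0 i) *: e i.
  apply: (@diagonal_op_exists _ _ _ dot_norm _ e_basis _ (expR eps)) => i.
  by rewrite norm_expR ler_expR; have := a01 i; lra.
have [D' D'e] : exists D : bounded_op H, forall i, D (e i) = expR (a0 i - a1 i) *: e i.
  apply: (@diagonal_op_exists _ _ _ dot_norm _ e_basis _ (expR 0)) => i.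
  by rewrite norm_expR ler_expR; have := a01 i; lra.
have DD' : op_comp D D' = op_id H.
  apply: (bop_eq dot_norm e_basis) => i /=.
  by rewrite D'e bopZ De scalerA -expRD [_ + _](_ : _ = 0) ?expR0 ?scale1r//; ring.
have D'D : op_comp D' D = op_id H.
  apply: (bop_eq dot_norm e_basis) => i /=.
  by rewrite De bopZ D'e scalerA -expRD [_ + _](_ : _ = 0) ?expR0 ?scale1r//; ring.
have appE (A B : bounded_op H) x : op_comp A B = op_id H -> A (B x) = x.
  by move=> /(congr1 (fun C : bounded_op H => C x)).
have T'e i : op_comp T D (e i) = expR (a1 i) *: e (i + 1).
  by rewrite /= De bopZ Ta scalerA -expRD subrK.
exists (op_comp T D); split => //.
  split.
    exists (op_comp D' S); split; apply/val_inj/funext => x /=.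
      by rewrite (appE D D')// (appE T S).
    by rewrite (appE S T)// (appE D' D).
  by exists (fun i => expR (a1 i)) => // i; exact: expR_gt0.
apply: (@opnorm_shift_le _ _ _ dot_norm _ e_basis _ 1 (fun i => expR (a0 i) - expR (a1 i))) => i.
  have -> : (T - op_comp T D) (e i) = T (e i) - op_comp T D (e i) by [].
  by rewrite T'e Ta -scalerBl.
have -> : expR (a1 i) = expR (a0 i) * expR (a1 i - a0 i) by rewrite -expRD; congr expR; ring.
rewrite -{1}[expR (a0 i)]mulr1 -mulrBr normrM norm_expR.
have /andP[h1 h2] := a01 i.
rewrite ler_pM// ?expR_ge0//.
  by rewrite -[leLHS]norm_expR (opnorm_shift_ge dot_norm e_basis i Ta).
rewrite distrC ger0_norm; last by rewrite subr_ge0 -expR0 ler_expR; lra.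
by rewrite lerD2r ler_expR; lra.
Qed.

(** The operator norm controls the weights uniformly, and near [L] they stay away from zero, where
    the logarithm is uniformly continuous. *)
Lemma close_log_weights L (eps : R) : shift_pairs e L -> 0 < eps ->
  exists2 delta, 0 < delta & forall L', shift_pairs e L' ->
    `|L.1 - L'.1| < delta -> `|L.2 - L'.2| < delta ->
    forall b i, `|log_weights L' b i - log_weights L b i| <= eps.
Proof.
move=> sL eps0; have [La [B aB]] := has_log_weightsP sL.
have q1 : expR (- eps) < 1 by rewrite -expR0 ltr_expR oppr_lt0.
(* [expR (- B)] bounds the weights of [L] from below, so an error of [delta] is at most the fraction
   [1 - expR (- eps)] of any weight. *)
pose delta := expR (- B) * (1 - expR (- eps)).
exists delta; first by rewrite mulr_gt0 ?expR_gt0// subr_gt0.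
move=> L1 sL1 d1 d2 b i; have [La1 _] := has_log_weightsP sL1.
set x := log_weights L1 b i; set y := log_weights L b i.
have dxy : `|expR y - expR x| <= delta.
  have db : `|letter_op L b - letter_op L1 b| <= delta by case: b {x y}; exact: ltW.
  apply: le_trans db.
  apply: (@opnorm_shift_ge _ _ _ dot_norm _ e_basis _ 1
    (fun i => expR (log_weights L b i) - expR (log_weights L1 b i)) i) => j.
  have -> : (letter_op L b - letter_op L1 b) (e j) = letter_op L b (e j) - letter_op L1 b (e j) by [].
  by rewrite La La1 -scalerBl.
have dy : delta <= expR y * (1 - expR (- eps)).
  rewrite ler_wpM2r ?subr_ge0 ?(ltW q1)// ler_expR.
  by have := aB b i; rewrite ler_norml => /andP[].
move: dxy; rewrite ler_norml => /andP[h1 h2].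
have y0 : 0 < expR y by rewrite expR_gt0.
rewrite ler_norml; apply/andP; split.
  suff : y - eps <= x by lra.
  rewrite -ler_expR expRD; lra.
suff : x <= y + eps by lra.
rewrite -ler_expR expRD.
(* The downward margin [1 - expR (- eps)] is at most the upward margin [expR eps - 1]. *)
have h3 : 2 - expR (- eps) <= expR eps.
  have := expR_ge1Dx eps; have := expR_ge1Dx (- eps).
  have : expR eps * expR (- eps) = 1 by rewrite -expRD subrr expR0.
  have := sqr_ge0 (expR eps - 1); have := expR_gt0 (- eps); nra.
have : expR y * (2 - expR (- eps)) <= expR y * expR eps by rewrite ler_wpM2l// ltW.
lra.
Qed.

End ShiftPairs.

Lemma nbhs_set_val (X : topologicalType) (A : set X) (x : A) (P : set X) (Q : set A) :
  nbhs (set_val x) P -> (forall y : A, P (set_val y) -> Q y) -> nbhs x Q.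
Proof.
move=> xP PQ; have : nbhs x (set_val @^-1` P) by exact: initial_continuous.
by apply: filterS.
Qed.

(** * Density and the countable intersection of open sets *)

Section Generic.
Variables (R : realType) (H : completeNormedModType R).
Variables (dot : {dot H for idfun}) (dot_norm : forall x : H, dot x x = `|x| ^+ 2).
Variables (e : int -> H) (e_basis : orthonormal_basis dot e).
Implicit Type L : shift_pairs e.

Lemma shift_pairs_val L : shift_pairs e (set_val L).
Proof. by rewrite set_valE; case: L => L /= /set_mem. Qed.

Definition weights_of L := log_weights e (set_val L).

Lemma bounded_weights_of L : bounded_weights (weights_of L).
Proof. exact: (has_log_weightsP dot_norm e_basis (shift_pairs_val L)).2. Qed.

Lemma maximisingP L mu : maximising_measure (set_val L) mu <-> optimal (weights_of L) mu.
Proof.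
have [La ba] := has_log_weightsP dot_norm e_basis (shift_pairs_val L).
exact: (maximising_optimal dot_norm e_basis La ba).
Qed.

Lemma nbhs_weights_of L (eps : R) : 0 < eps ->
  \forall L' \near L, forall b i, `|weights_of L' b i - weights_of L b i| <= eps.
Proof.
move=> eps0.
have [delta d0 Hd] := close_log_weights dot_norm e_basis (shift_pairs_val L) eps0.
apply: (nbhs_set_val (nbhsx_ballx (set_val L) _ d0)) => L' [b1 b2].
apply: Hd (shift_pairs_val L') _ _; by rewrite -ball_normE in b1, b2.
Qed.

Lemma dense_unique_maximising :
  dense ([set L | unique_maximising_measure (set_val L)] : set (shift_pairs e)).
Proof.
move=> O [L OL] [V oV VO].
have VL : V (set_val L) by move: OL; rewrite -VO.
have [r r0 rV] : exists2 r : R, 0 < r & ball (set_val L) r `<=` V.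
  by have /nbhs_ballP[r r0 rV] := open_nbhs_nbhs (conj oV VL); exists r.
have [sp1 sp2] := shift_pairs_val L.
have [La ba] := has_log_weightsP dot_norm e_basis (shift_pairs_val L).
set T1 := (set_val L).1 in sp1; set T2 := (set_val L).2 in sp2.
pose K := `|T1| + `|T2| + 1.
have K0 : 0 < K by rewrite ltr_wpDl// addr_ge0.
have rK : 1 < 1 + r / (2 * K) by rewrite ltrDl divr_gt0// mulr_gt0.
(* With [expR eps - 1 = r / (2 * K)] each operator moves by at most [r / 2], inside the ball of
   radius [r]. *)
pose eps := ln (1 + r / (2 * K)).
have eps0 : 0 < eps by rewrite ln_gt0.
have epsE : expR eps - 1 = r / (2 * K) by rewrite lnK ?posrE ?(lt_trans ltr01 rK)// addrC addKr.
have [a' [ba' aa' ua']] := exists_unique_optimal ba eps0.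
have [T2' [s2 T2'e T2'n]] := perturb_shift dot_norm e_basis (ltW eps0) sp2 (La true) (aa' true).
have [T1' [s1 T1'e T1'n]] := perturb_shift dot_norm e_basis (ltW eps0) sp1 (La false) (aa' false).
have close (T T' : bounded_op H) : `|T| <= K -> `|T - T'| <= `|T| * (expR eps - 1) -> ball T r T'.
  move=> TK TT'; rewrite -ball_normE /=; apply: le_lt_trans TT' _.
  rewrite epsE; apply: (@le_lt_trans _ _ (K * (r / (2 * K)))).
    by rewrite ler_wpM2r// divr_ge0 ?mulr_ge0 ?ltW.
  have -> : K * (r / (2 * K)) = r / 2 by field; rewrite gt_eqF.
  lra.
have sL' : (T1', T2') \in shift_pairs e by apply/mem_set; split.
pose L' : shift_pairs e := exist _ (T1', T2') sL'.
have L'E : set_val L' = (T1', T2') by rewrite set_valE.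
have La' : has_log_weights e (set_val L') a'.
  by rewrite L'E; case=> i; [exact: T2'e|exact: T1'e].
have aE : weights_of L' = a' by exact: (log_weightsE dot_norm e_basis La').
exists L'; split.
  rewrite -VO /=; apply: rV; rewrite L'E; split; apply: close => //.
    by rewrite /K -addrA lerDl addr_ge0.
  by rewrite /K addrAC lerDr addr_ge0.
have [mu omu] := exists_optimal ba'.
exists mu; first by apply/maximisingP; rewrite aE.
move=> nu /maximisingP; rewrite aE => onu.
by apply: eq_probability_cyl => s; exact: ua'.
Qed.

(** Since [mu] and [nu] may be exchanged, the signed difference controls both directions. *)
Definition discrepancy_set (s : seq (int * bool)) (d : R) : set (shift_pairs e) :=
  [set L | forall mu nu, optimal (weights_of L) mu -> optimal (weights_of L) nu ->
    fine (mu (cyl s)) - fine (nu (cyl s)) < d].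

(** Otherwise an ultrafilter on the complement converges to [L]. Pairs of optimal measures that
    differ by at least [d] then converge weakly to such a pair for [L] itself, by
    [optimal_ultra]. *)
Lemma open_discrepancy_set s d : 0 < d -> open (discrepancy_set s d).
Proof.
move=> d0; rewrite openE => L FL; rewrite /interior; apply: contrapT => nF.
have PF : ProperFilter (within (~` discrepancy_set s d) (nbhs L)).
  split; last exact: within_filter.
  move=> h; apply: nF; move: h; rewrite /within/=; apply: filterS => t.
  by move=> h; apply: contrapT.
have [U [UU FU]] := ultraFilterLemma PF.
have /choice[mn mnP] : forall t : shift_pairs e, exists mn : probability full_shift R * probability full_shift R,
    [/\ optimal (weights_of t) mn.1, optimal (weights_of t) mn.2 &
      (~` discrepancy_set s d) t -> d <= fine (mn.1 (cyl s)) - fine (mn.2 (cyl s))].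
  (* For [t] inside the set the last condition is vacuous, and one optimal measure taken twice
     serves as the pair. *)
  move=> t; have [tF|] := pselect (discrepancy_set s d t).
    have [mu omu] := exists_optimal (bounded_weights_of t).
    by exists (mu, mu).
  move=> /existsNP[mu /existsNP[nu /not_implyP[omu /not_implyP[onu /negP]]]].
  by rewrite -leNgt => h; exists (mu, nu).
have [mu muE] := cyl_content_ultra UU (fun t => cyl_content_probability (mn t).1).
have [nu nuE] := cyl_content_ultra UU (fun t => cyl_content_probability (mn t).2).
have nL A : nbhs L A -> U A by move=> LA; apply: FU; rewrite /within/=; apply: filterS LA.
have close eps : 0 < eps -> \forall t \near U,
    forall b i, `|weights_of t b i - weights_of L b i| <= eps.
  by move=> eps0; apply: nL; exact: nbhs_weights_of.
have omu : optimal (weights_of L) mu.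
  apply: (optimal_ultra UU (bounded_weights_of L) bounded_weights_of close _ muE) => t.
  by have [] := mnP t.
have onu : optimal (weights_of L) nu.
  apply: (optimal_ultra UU (bounded_weights_of L) bounded_weights_of close _ nuE) => t.
  by have [] := mnP t.
have := FL _ _ omu onu; apply/negP; rewrite -leNgt.
apply: (cvgr_to_ge (cvgB (muE s) (nuE s))).
have : U (~` discrepancy_set s d) by apply: FU; rewrite /within/=; exact: nearW.
by apply: filterS => t tF; have [_ _] := mnP t; exact.
Qed.

Lemma Gdelta_unique_maximising :
  Gdelta ([set L | unique_maximising_measure (set_val L)] : set (shift_pairs e)).
Proof.
pose idx k : seq (int * bool) * nat := odflt ([::], 0%N) (unpickle k).
exists (fun k => discrepancy_set (idx k).1 (idx k).2.+1%:R^-1).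
  by move=> k; apply: open_discrepancy_set; rewrite invr_gt0.
apply/seteqP; split => L /=.
  move=> [mu mmu umu] k _ la nu ola onu.
  have E p : optimal (weights_of L) p -> fine (p (cyl (idx k).1)) = fine (mu (cyl (idx k).1)).
    by move=> /maximisingP op; rewrite (umu _ op)//; exact: measurable_cyl.
  by rewrite !E// subrr invr_gt0.
move=> FL; have [mu omu] := exists_optimal (bounded_weights_of L).
exists mu; first exact/maximisingP.
have le_opt s p q : optimal (weights_of L) p -> optimal (weights_of L) q ->
    fine (p (cyl s)) <= fine (q (cyl s)).
  move=> op oq; apply/ler_addgt0Pr => d d0.
  pose j := Num.bound d^-1.
  have := FL (pickle (s, j)) I p q op oq; rewrite /idx pickleK /= => h.
  rewrite -lerBlDl; apply: le_trans (ltW h) _.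
  rewrite -[leRHS]invrK lef_pV2 ?posrE ?invr_gt0//.
  have dj : d^-1 < j%:R by apply: archi_boundP; rewrite invr_ge0 ltW.
  by apply: le_trans (ltW dj) _; rewrite ler_nat.
move=> nu /maximisingP onu; apply: eq_probability_cyl => s.
have fn (la : probability full_shift R) : la (cyl s) \is a fin_num.
  by apply: fin_num_measure; exact: measurable_cyl.
rewrite -(fineK (fn nu)) -(fineK (fn mu)); congr EFin.
by apply/le_anti; rewrite !le_opt.
Qed.

End Generic.

Theorem theorem1p4 (R : realType) (H : completeNormedModType R)
    (dot : {dot H for idfun}) (dot_norm : forall x : H, dot x x = `|x| ^+ 2)
    (e : int -> H) (e_basis : orthonormal_basis dot e) :
  let U : set (shift_pairs e) :=
    [set L | unique_maximising_measure (set_val L)] in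
  dense U /\ Gdelta U.
Proof.
move=> U; split; [exact: (dense_unique_maximising dot_norm e_basis)|].
exact: (Gdelta_unique_maximising dot_norm e_basis).
Qed.
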